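(* For any $2\le n\le\infty$ and $1\le d\le\infty$, there exist continuously many (i.e. a set of the cardinality of the continuum of) mutually inequivalent pure states $\omega$ on $\mathcal{O}_n$ which are minimal and satisfy $\kappa(\omega)=d$.
   Context: For $2\le n\le\infty$, $\mathcal{O}_n$ is the Cuntz algebra with Cuntz generators $s_1,\ldots,s_n$ (a sequence $s_1,s_2,\ldots$ if $n=\infty$): the universal unital C*-algebra generated by elements with $s_i^*s_j=\delta_{ij}I$ and $\sum_{i=1}^n s_is_i^*=I$ if $n<\infty$, respectively $\sum_{i=1}^k s_is_i^*\le I$ for all $k\geq 1$ if $n=\infty$. When $n=\infty$, $\{1,\ldots,n\}$ means $\{1,2,\ldots\}$. Let $\mathcal{I}_n=\bigcup_{l\ge0}\{1,\ldots,n\}^l$ be the set of finite words, $\{1,\ldots,n\}^0=\{\emptyset\}$, $s_J=s_{j_1}\cdots s_{j_l}$ for $J=(j_1,\ldots,j_l)$, $s_\emptyset=I$. For states $\omega,\omega'$ on $\mathcal{O}_n$, write $\omega\sim\omega'$ (equivalent) if their GNS representations are unitarily equivalent; otherwise they are inequivalent. For a state $\omega$ with GNS representation $(\mathcal{H},\pi,\Omega)$, let $\mathcal{K}(\omega)$ be the closed linear span of $\{\pi(s_J)^*\Omega: J\in\mathcal{I}_n\}$ in $\mathcal{H}$, $\mathrm{c}\dim\omega:=\dim\mathcal{K}(\omega)\in\{1,2,\ldots,\infty\}$ (Hilbert space dimension, $\infty$ meaning countably infinite), and $\kappa(\omega):=\min\{\mathrm{c}\dim\omega':\omega'\text{ a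 state on }\mathcal{O}_n,\ \omega'\sim\omega\}$. A state $\omega$ is minimal if $\mathrm{c}\dim\omega=\kappa(\omega)$. *)

(* Defs.v *)
From HB Require Import structures.
From mathcomp Require Import all_boot all_order all_algebra.
From mathcomp Require Import all_classical all_reals all_analysis.
From mathcomp Require Import complex.

Set Implicit Arguments.
Unset Strict Implicit.
Unset Printing Implicit Defensive.

Import Order.TTheory GRing.Theory Num.Theory.
Import numFieldNormedType.Exports.

Local Open Scope classical_set_scope.
Local Open Scope ring_scope.

(* The natural numbers together with infinity. *)
Inductive enat := Fin of nat | Inf.

Definition le_enat (m n : enat) : bool :=
  match m, n with
  | _, Inf => true
  | Inf, Fin _ => false
  | Fin i, Fin j => (i <= j)%N
  end.

(* The index set {1, ..., n}, or {1, 2, ...} if n is infinite, shifted to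
   start at 0. *)
Definition idx (n : enat) : countType :=
  match n with Fin m => 'I_m : countType | Inf => nat : countType end.

(* Unital C*-algebras over C (below, C is R[i] with R a realType). The norm of
   a normedModType C takes its values in the nonnegative reals of C. The ring
   structure is given by explicit fields because Hierarchy Builder cannot join
   the normed modules with the rings of the library after the fact. *)
HB.mixin Record isCStarAlgebra (C : numClosedFieldType) A
    of CompleteNormedModule C A := {
  cone : A ;
  cmul : A -> A -> A ;
  cmulA : associative cmul ;
  cmul1x : left_id cone cmul ;
  cmulx1 : right_id cone cmul ;
  cmul_linearl : forall y : A, linear (fun x : A => cmul x y) ;
  cmul_linearr : forall x : A, linear (fun y : A => cmul x y) ;
  star : A -> A ;
  starK : involutive star ;
  star_antilinear : forall (a : C) (x y : A),
    star (a *: x + y) = Num.conj a *: star x + star y ;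
  star_mul : forall x y : A, star (cmul x y) = cmul (star y) (star x) ;
  cnorm_mul : forall x y : A, `|cmul x y| <= `|x| * `|y| ;
  cnorm_star : forall x : A, `|cmul (star x) x| = `|x| ^+ 2
}.

#[short(type="cstarAlgType")]
HB.structure Definition CStarAlgebra (C : numClosedFieldType) :=
  {A of CompleteNormedModule C A & isCStarAlgebra C A}.

Arguments cone {C A} : rename.
Arguments cmul {C A} : rename.
Arguments star {C A} : rename.

(* Hilbert spaces over C. A form of type {dot H for Num.conj} is linear in its
   first argument and conjugate-linear in its second one. *)
HB.mixin Record isHilbert (C : numClosedFieldType) H
    of CompleteNormedModule C H := {
  hdot : {dot H for @Num.conj C} ;
  hdot_norm : forall x : H, `|x| ^+ 2 = hdot x x
}.

#[short(type="hilbertType")]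
HB.structure Definition Hilbert (C : numClosedFieldType) :=
  {H of CompleteNormedModule C H & isHilbert C H}.

Arguments hdot {C H} : rename.

Section HilbertDimension.
Context {C : numClosedFieldType} {H : hilbertType C}.

Definition lin_subspace (V : set H) : Prop :=
  V 0 /\ forall (a : C) (x y : H), V x -> V y -> V (a *: x + y).

Definition closed_span (X : set H) : set H :=
  smallest [set V | closed V /\ lin_subspace V] X.

(* V has an orthonormal basis indexed by idx d. *)
Definition has_hdim (V : set H) (d : enat) : Prop :=
  exists e : idx d -> H,
    (forall i j, hdot (e i) (e j) = (i == j)%:R) /\
    closed_span (range e) = V.

End HilbertDimension.

Section CStarAlgebras.
Context {C : numClosedFieldType}.

Definition unital_star_hom (A B : cstarAlgType C) (f : A -> B) : Prop :=
  [/\ linear f, f cone = cone,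
      forall x y, f (cmul x y) = cmul (f x) (f y) &
      forall x, f (star x) = star (f x)].

Definition le_cstar {A : cstarAlgType C} (x y : A) : Prop :=
  exists z : A, y - x = cmul (star z) z.

Definition closed_unital_star_subalg {A : cstarAlgType C} (B : set A) : Prop :=
  [/\ closed B, B cone,
      forall (a : C) x y, B x -> B y -> B (a *: x + y),
      forall x y, B x -> B y -> B (cmul x y) &
      forall x, B x -> B (star x)].

(* The Cuntz relations of s_1, ..., s_n. *)
Definition cuntz_relations {A : cstarAlgType C} (n : enat) :
    (idx n -> A) -> Prop :=
  match n return (idx n -> A) -> Prop with
  | Fin m => fun s : 'I_m -> A =>
      (forall i j, cmul (star (s i)) (s j) = (i == j)%:R *: cone) /\
      \sum_(i < m) cmul (s i) (star (s i)) = cone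
  | Inf => fun s : nat -> A =>
      (forall i j, cmul (star (s i)) (s j) = (i == j)%:R *: cone) /\
      forall k, (0 < k)%N ->
        le_cstar (\sum_(i < k) cmul (s i) (star (s i))) cone
  end.

(* (A, s) is O_n with its Cuntz generators: the universal unital C*-algebra
   generated by elements satisfying the Cuntz relations. *)
Definition is_cuntz_algebra (n : enat) (A : cstarAlgType C)
    (s : idx n -> A) : Prop :=
  [/\ cuntz_relations s,
      smallest (@closed_unital_star_subalg A) (range s) = setT &
      forall (B : cstarAlgType C) (t : idx n -> B), cuntz_relations t ->
        exists f : A -> B, unital_star_hom f /\ forall i, f (s i) = t i].

Section States.
Context {A : cstarAlgType C}.

Definition is_state (w : A -> C) : Prop :=
  [/\ scalar w, forall x, 0 <= w (cmul (star x) x) & w cone = 1].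

Definition is_pure (w : A -> C) : Prop :=
  is_state w /\
  forall (t : C) (u v : A -> C), 0 < t < 1 -> is_state u -> is_state v ->
    (forall x, w x = t * u x + (1 - t) * v x) -> u = w /\ v = w.

(* Unital *-representations on H by bounded operators. *)
Definition is_rep (H : hilbertType C) (pi : A -> H -> H) : Prop :=
  [/\ forall a, linear (pi a) /\ continuous (pi a),
      forall (k : C) a b x, pi (k *: a + b) x = k *: pi a x + pi b x,
      forall x, pi cone x = x,
      forall a b x, pi (cmul a b) x = pi a (pi b x) &
      forall a x y, hdot (pi (star a) x) y = hdot x (pi a y)].

Definition is_GNS (w : A -> C) (H : hilbertType C) (pi : A -> H -> H)
    (Om : H) : Prop :=
  [/\ is_rep pi, closure (range (fun a => pi a Om)) = setT &
      forall a, w a = hdot (pi a Om) Om].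

Definition unitarily_equivalent (H1 H2 : hilbertType C)
    (pi1 : A -> H1 -> H1) (pi2 : A -> H2 -> H2) : Prop :=
  exists U : H1 -> H2,
    [/\ linear U, range U = setT,
        forall x y, hdot (U x) (U y) = hdot x y &
        forall a x, U (pi1 a x) = pi2 a (U x)].

(* GNS representations exist and are unique up to unitary equivalence, so it
   does not matter which ones are chosen here and in has_cdim. *)
Definition state_equiv (w w' : A -> C) : Prop :=
  exists (H H' : hilbertType C) (pi : A -> H -> H) (pi' : A -> H' -> H')
    (Om : H) (Om' : H'),
    [/\ is_GNS w pi Om, is_GNS w' pi' Om' & unitarily_equivalent pi pi'].

Context {n : enat} (s : idx n -> A).

Definition word_prod (J : seq (idx n)) : A :=
  foldr (fun j x => cmul (s j) x) cone J.

(* pi(s_J)^* is written pi(s_J^* ), its value for a *-representation. *)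
Definition Kspace (H : hilbertType C) (pi : A -> H -> H) (Om : H) : set H :=
  closed_span (range (fun J => pi (star (word_prod J)) Om)).

(* cdim w = d *)
Definition has_cdim (w : A -> C) (d : enat) : Prop :=
  exists (H : hilbertType C) (pi : A -> H -> H) (Om : H),
    is_GNS w pi Om /\ has_hdim (Kspace pi Om) d.

(* kappa w = d *)
Definition has_kappa (w : A -> C) (d : enat) : Prop :=
  (exists w', [/\ is_state w', state_equiv w' w & has_cdim w' d]) /\
  forall w' d', is_state w' -> state_equiv w' w -> has_cdim w' d' ->
    le_enat d d'.

Definition is_minimal (w : A -> C) : Prop :=
  exists d, has_cdim w d /\ has_kappa w d.

End States.
End CStarAlgebras.

(* Main.v *)
Require Import Defs.
From HB Require Import structures.
From mathcomp Require Import all_boot all_order all_algebra.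
From mathcomp Require Import all_classical all_reals all_analysis.
From mathcomp Require Import complex.
From mathcomp Require Import ring.

(** For an infinite word x = x_0 x_1 ... in the letters of O_n let O_n act on
l2 of the set of all words having a tail in common with x, by sending the basis
vector e_y to e_{iy} under s_i, except that the one edge leading to x itself is
weighted by a complex number z of modulus 1. Let w be the vector state of e_x.
The adjoints of the s_J move e_x, up to scalars, to the vectors e_{tail of x},
so that K(w) has the distinct tails of x as an orthonormal basis. There are d of
them if x has exact period d, and infinitely many if no two tails agree.

Write p_m for the range projection of s_J, where J is the prefix of x of length
m. Then w(p_m) = 1 for all m (w follows x), and if x has period d then
w(s_J) = z for the prefix J of length d. These values determine w. Indeed, let
phi be a functional with phi(p_m a) = phi(a) = phi(a q_m), with q_m the
analogous projections of a word y. If I is not a prefix of x, K not a prefix of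
y, or the tails of x and y that remain differ, then inserting long enough p_m
and q_m shows that phi vanishes at s_I times the adjoint of s_K
([functional_support]). These elements span a dense subspace ([cuntz_span]) and
states are contractive ([state_bounded]), hence uniqueness ([follows_unique]).
Because 1 and z are extreme in the unit disc, all states of a convex
decomposition of w take the same values, and w is pure ([follows_pure]).

If w and w' are equivalent then, up to a unitary, their cyclic vectors Om and
Om' lie in one space, and phi(a) = <a Om', Om> is a nonzero functional
([equiv_functional]). If w follows x and w' follows x', then phi satisfies the
above with x on the left and x' on the right. So w and w' are inequivalent when
x and x' have no common tail, and also when x = x' is periodic but the phases
differ, because then phi(s_J) equals both z phi(1) and z' phi(1)
([follows_inequivalent], [phase_inequivalent]).

For minimality let w' be equivalent to w, with cyclic vector v of w'. As phi is
nonzero at some s_I times the adjoint of s_K, there are a word y sharing a tail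
with x and a c > 0 such that the vectors v_m, the images of v under the adjoint
of s_J for J the prefix of y of length m, all have norm at least c
([follows_equiv_tail]). Their norms decrease, hence converge, and this forces
v_m to be almost in the range of s_T for every prefix T of the m-th tail of y.
Different tails lead to orthogonal ranges, so the v_m, which lie in K(w'), are
almost orthogonal, and K(w') has dimension at least the number of distinct tails
([kspace_dim_ge], [cdim_ge]).

A continuum of states comes from the phases on the unit circle if d is finite,
with the periodic word 0...01, and from words that encode the Dedekind cuts of
the real numbers if d is infinite ([cut_mark_separates]).

The representation above is obtained from the universal property of O_n, for
which l2 must be a Hilbert space and its bounded operators a C*-algebra. The
contractivity of states rests on square roots 1 - x = y* y, given by a fixed
point ([one_minus_square]). *)

Set Implicit Arguments.
Unset Strict Implicit.
Unset Printing Implicit Defensive.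

Import Order.TTheory GRing.Theory Num.Theory.
Import numFieldNormedType.Exports.

Local Open Scope classical_set_scope.
Local Open Scope ring_scope.

(** * Positive sesquilinear forms *)

Section PosForm.
Variables (C : numClosedFieldType) (U : lmodType C) (f : U -> U -> C).
Hypothesis fl : forall (a : C) x y z, f (a *: x + y) z = a * f x z + f y z.
Hypothesis fh : forall x y, f y x = Num.conj (f x y).
Hypothesis fp : forall x, 0 <= f x x.

Lemma pform_lD x y z : f (x + y) z = f x z + f y z.
Proof. by rewrite -[x]scale1r fl mul1r scale1r. Qed.

Lemma pform_l0 z : f 0 z = 0.
Proof. by apply: (addrI (f 0 z)); rewrite -pform_lD !addr0. Qed.

Lemma pform_lZ a x z : f (a *: x) z = a * f x z.
Proof. by rewrite -[a *: x]addr0 fl pform_l0 addr0. Qed.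

Lemma pform_rD x y z : f z (x + y) = f z x + f z y.
Proof. by rewrite fh pform_lD rmorphD /= -!fh. Qed.

Lemma pform_rZ a x z : f z (a *: x) = Num.conj a * f z x.
Proof. by rewrite fh pform_lZ rmorphM /= -!fh. Qed.

(** The form is nonnegative on f y y *: x - f x y *: y, which proves this when
f y y is nonzero. The form may be degenerate, so f y y = 0 is treated apart: then
x and y exchange roles, and if f x x vanishes too, f x y *: y is compared with x
directly. *)
Lemma pform_CS x y : `|f x y| ^+ 2 <= f x x * f y y.
Proof.
have E (a b : C) : f (a *: x + b *: y) (a *: x + b *: y) =
    `|a| ^+ 2 * f x x + a * Num.conj b * f x y +
    (b * Num.conj a * Num.conj (f x y) + `|b| ^+ 2 * f y y).
  rewrite fl !pform_rD !pform_lZ !pform_rZ (fh x y) !normCK; ring.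
have rx : Num.conj (f x x) = f x x by rewrite -fh.
have ry : Num.conj (f y y) = f y y by rewrite -fh.
have [y0|y0] := eqVneq (f y y) 0.
  have [x0|x0] := eqVneq (f x x) 0.
    have := fp ((- f y x) *: x + 1 *: y); rewrite E x0 y0 fh normrN.
    rewrite !rmorphN /= conjCK rmorph1 mulr0 !mulr1 mul1r.
    set z := `|f x y|.
    have zE : f x y * Num.conj (f x y) = z ^+ 2 by rewrite normCK.
    rewrite [leRHS](_ : _ = - (2 * z ^+ 2)); last by rewrite -zE; ring.
    by rewrite oppr_ge0 pmulr_rle0// mulr0.
  have := fp ((f x x) *: y + (- f y x) *: x); rewrite addrC E fh.
  have x1 : 0 < f x x by rewrite lt_def x0 fp.
  rewrite !rmorphN /= conjCK y0 rx normrN norm_conjC !mulr0 addr0.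
  set z := `|f x y|.
  have zE : f x y * Num.conj (f x y) = z ^+ 2 by rewrite normCK.
  rewrite [leRHS](_ : _ = - (f x x * z ^+ 2)); last by rewrite -zE; ring.
  by rewrite oppr_ge0 pmulr_rle0.
have y1 : 0 < f y y by rewrite lt_def y0 fp.
have := fp ((f y y) *: x + (- f x y) *: y); rewrite E.
rewrite !rmorphN /= ry normrN (ger0_norm (fp y)).
set z := `|f x y|.
have zE : f x y * Num.conj (f x y) = z ^+ 2 by rewrite normCK.
rewrite [leRHS](_ : _ = f y y * (f x x * f y y - z ^+ 2)); last by rewrite -zE; ring.
by rewrite pmulr_rge0// subr_ge0.
Qed.

Lemma pform_triangle x y :
  sqrtC (f (x + y) (x + y)) <= sqrtC (f x x) + sqrtC (f y y).
Proof.
rewrite -(@ler_pXn2r _ 2) ?nnegrE ?addr_ge0 ?sqrtC_ge0// sqrtCK sqrrD !sqrtCK.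
rewrite pform_lD !pform_rD (fh x y).
have -> : f x x + f x y + (Num.conj (f x y) + f y y) =
  f x x + (f x y + Num.conj (f x y)) + f y y by ring.
rewrite lerD2r lerD2l.
have h : `|f x y| <= sqrtC (f x x) * sqrtC (f y y).
  rewrite -(@ler_pXn2r _ 2) ?nnegrE ?mulr_ge0 ?sqrtC_ge0//.
  by rewrite exprMn !sqrtCK pform_CS.
rewrite -mulr_natl; apply: le_trans (_ : 2 * `|f x y| <= _); last by rewrite ler_wpM2l.
have rr : f x y + Num.conj (f x y) \is Num.real.
  by rewrite CrealE rmorphD /= conjCK addrC.
apply: le_trans (real_ler_norm rr) _.
by apply: le_trans (ler_normD _ _) _; rewrite norm_conjC mulr_natl mulr2n.
Qed.
End PosForm.

(** * Unordered sums *)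

Section HasSum.
Variables (C : numClosedFieldType) (X : choiceType).
Implicit Types (f g : X -> C) (c d : C).

(** Limit along the directed set of finite subsets of X, listed without
repetition. No order on X is involved, so injective reindexing is immediate. *)
Definition has_sum f c := forall e : C, 0 < e -> exists s0 : seq X,
  forall s, uniq s -> {subset s0 <= s} -> `|\sum_(x <- s) f x - c| <= e.

Lemma has_sum_unique f c d : has_sum f c -> has_sum f d -> c = d.
Proof.
move=> fc fd; apply/eqP; rewrite -subr_eq0 -normr_le0.
apply/ler_addgt0Pr => e e0; rewrite add0r.
have e2 : 0 < e / 2 by rewrite divr_gt0.
have [s0 h0] := fc _ e2; have [s1 h1] := fd _ e2.
pose s := undup (s0 ++ s1).
have us : uniq s by rewrite undup_uniq.
have /(h0 _ us) a0 : {subset s0 <= s} by move=> x; rewrite mem_undup mem_cat => ->.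
have /(h1 _ us) a1 : {subset s1 <= s} by move=> x; rewrite mem_undup mem_cat orbC => ->.
rewrite (splitr e); apply: le_trans (ler_distD (\sum_(x <- s) f x) _ _) _.
by rewrite lerD// distrC.
Qed.

Lemma has_sumD f g c d : has_sum f c -> has_sum g d ->
  has_sum (fun x => f x + g x) (c + d).
Proof.
move=> fc gd e e0.
have e2 : 0 < e / 2 by rewrite divr_gt0.
have [s0 h0] := fc _ e2; have [s1 h1] := gd _ e2.
exists (s0 ++ s1) => s us sub; rewrite big_split /= opprD addrACA (splitr e).
apply: le_trans (ler_normD _ _) _; apply: lerD.
  by apply: h0 => // x xs; apply: sub; rewrite mem_cat xs.
by apply: h1 => // x xs; apply: sub; rewrite mem_cat xs orbT.
Qed.

Lemma has_sumZ f c a : has_sum f c -> has_sum (fun x => a * f x) (a * c).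
Proof.
move=> fc e e0.
have a1 : 0 < `|a| + 1 by rewrite ltr_wpDl.
have [s0 h0] := fc (e / (`|a| + 1)) (divr_gt0 e0 a1).
exists s0 => s us sub; rewrite -mulr_sumr -mulrBr normrM.
apply: le_trans (_ : (`|a| + 1) * (e / (`|a| + 1)) <= _).
  by apply: ler_pM => //; [rewrite lerDl|exact: h0].
by rewrite mulrCA divff ?mulr1// gt_eqF.
Qed.

Lemma has_sum_conj f c : has_sum f c ->
  has_sum (fun x => Num.conj (f x)) (Num.conj c).
Proof.
move=> fc e /fc[s0 h0]; exists s0 => s us sub.
by rewrite -rmorph_sum -rmorphB norm_conjC h0.
Qed.

Lemma eq_has_sum f g c : f =1 g -> has_sum f c -> has_sum g c.
Proof. by move=> /funext ->. Qed.

Lemma sum_subset f s0 s : (forall x, 0 <= f x) -> uniq s0 -> uniq s ->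
  {subset s0 <= s} -> \sum_(x <- s0) f x <= \sum_(x <- s) f x.
Proof.
move=> f0 u0 us sub; rewrite [leRHS](bigID (mem s0)) /= -[X in _ <= X + _]big_filter.
have -> : \sum_(x <- [seq x <- s | x \in s0]) f x = \sum_(x <- s0) f x.
  apply: perm_big; apply: uniq_perm; rewrite ?filter_uniq// => x.
  by rewrite mem_filter; case: (boolP (x \in s0)) => // /sub ->.
by rewrite lerDl sumr_ge0.
Qed.

(** Partial sums over larger sets are larger, and among them are some that are
close to c. *)
Lemma has_sum_ub f c s : (forall x, 0 <= f x) -> has_sum f c -> uniq s ->
  \sum_(x <- s) f x <= c.
Proof.
move=> f0 fc us; apply/ler_addgt0Pr => e e0; have [s0 h0] := fc _ e0.
pose s1 := undup (s ++ s0).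
have us1 : uniq s1 by rewrite undup_uniq.
have /(h0 _ us1) a0 : {subset s0 <= s1}.
  by move=> x; rewrite mem_undup mem_cat orbC => ->.
apply: le_trans (_ : \sum_(x <- s1) f x <= _).
  by apply: sum_subset => // x; rewrite mem_undup mem_cat => ->.
rewrite -lerBlDl; apply: le_trans a0; apply: real_ler_norm.
have rs s2 : \sum_(x <- s2) f x \is Num.real.
  by rewrite ger0_real// sumr_ge0.
rewrite rpredB//.
apply/CrealP; apply: has_sum_unique (fc).
move: (has_sum_conj fc); apply: eq_has_sum => x.
by rewrite (CrealP (ger0_real (f0 x))).
Qed.

Lemma has_sum_le f c b : (forall x, 0 <= f x) -> has_sum f c ->
  (forall s, uniq s -> \sum_(x <- s) f x <= b) -> c <= b.
Proof.
move=> f0 fc h; apply/ler_addgt0Pr => e /fc[s0 h0].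
have u0 := undup_uniq s0.
have /(h0 _ u0) : {subset s0 <= undup s0} by move=> x; rewrite mem_undup.
have c0 : 0 <= c by have := has_sum_ub f0 fc (isT : uniq [::]); rewrite big_nil.
have s1 : 0 <= \sum_(x <- undup s0) f x by rewrite sumr_ge0.
move=> /(le_trans _) a; have := h _ u0; rewrite -(lerD2r e); apply: le_trans.
rewrite -lerBlDl; apply: a; rewrite distrC.
by rewrite real_ler_norm// rpredB// ger0_real.
Qed.

End HasSum.

(** * Order completeness of the scalars *)

(** The least upper bound property of the nonnegative real axis of C. It makes C
the complex numbers up to isomorphism, while C itself remains an abstract field:
norms, limits and the Archimedean property below are all drawn from it. *)
Definition lub_property (C : numClosedFieldType) :=
  forall (S : set C) (M : C), S !=set0 -> (forall x, S x -> 0 <= x <= M) ->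
  exists c : C, (forall x, S x -> x <= c) /\
    forall b, (forall x, S x -> x <= b) -> c <= b.

Lemma complex_lub (R : realType) : lub_property R[i].
Proof.
move=> S M S0 SM; pose E := [set complex.Re x | x in S].
have reE (x : R[i]) : 0 <= x -> x = (complex.Re x)%:C%C.
  by move=> x0; rewrite RRe_real// ger0_real.
have E0 : E !=set0 by case: S0 => x Sx; exists (complex.Re x), x.
have Eub : has_ubound E.
  exists (complex.Re M) => _ [x Sx <-]; have /andP[x0 xM] := SM _ Sx.
  by move: xM; rewrite lecE => /andP[].
exists (sup E)%:C%C; split=> [x Sx|b Sb].
  have /andP[x0 xM] := SM _ Sx; rewrite [x]reE// lecR.
  by apply: ub_le_sup => //; exists x.
have [x Sx] := S0; have /andP[x0 _] := SM _ Sx.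
have b0 : 0 <= b by apply: le_trans x0 (Sb _ Sx).
rewrite [b]reE// lecR; apply: ge_sup => // _ [y Sy <-].
by have := Sb _ Sy; rewrite lecE => /andP[].
Qed.

Section Lub.
Variables (C : numClosedFieldType) (lubC : lub_property C).

(** The sum is the least upper bound of the finite partial sums. *)
Lemma has_sum_exists (X : choiceType) (f : X -> C) (M : C) :
  (forall x, 0 <= f x) -> (forall s, uniq s -> \sum_(x <- s) f x <= M) ->
  exists c, has_sum f c.
Proof.
move=> f0 fM.
pose S := [set \sum_(x <- s) f x | s in [set s : seq X | uniq s]].
have [] := lubC (S := S) (M := M).
- by exists 0, [::]; rewrite ?big_nil.
- by move=> _ [s us <-]; rewrite fM// sumr_ge0.
move=> c [ub lub]; exists c => e e0; apply: contrapT => hn.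
suff /lub : forall x, S x -> x <= c - e.
  by rewrite lerDl oppr_ge0 lt_geF.
move=> _ [s us <-]; rewrite lerBrDr.
apply: contrapT => /negP.
have c0 : 0 <= c by apply: ub; exists [::]; rewrite ?big_nil.
have s1 t : 0 <= \sum_(x <- t) f x by rewrite sumr_ge0.
rewrite -real_ltNge; last 2 first.
- exact: ger0_real.
- by rewrite ger0_real// addr_ge0// ltW.
move=> h; apply: hn; exists s => t ut st.
have tc : \sum_(x <- t) f x <= c by apply: ub; exists t.
rewrite distrC ger0_norm ?subr_ge0// lerBlDl -lerBlDr.
rewrite lerBlDr; apply: le_trans (ltW h) _; rewrite lerD2r.
exact: sum_subset.
Qed.

Lemma lub_archimedean (x : C) : 0 <= x -> exists n : nat, x < n%:R.
Proof.
move=> x0; apply: contrapT => hn.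
have hx n : n%:R <= x.
  rewrite real_leNgt ?ger0_real//; apply/negP => h; apply: hn; by exists n.
have [||c [ub lb]] := lubC (S := [set n%:R | n in [set: nat]]) (M := x).
- by exists 0, 0%N.
- by move=> _ [n _ <-]; rewrite hx ler0n.
suff /lb : forall y, [set n%:R | n in [set: nat]] y -> y <= c - 1.
  by rewrite lerDl oppr_ge0 lt_geF.
by move=> _ [n _ <-]; rewrite lerBrDr natr1; apply: ub; exists n.+1.
Qed.

(** Bernoulli's inequality for the powers of 1/r, and the Archimedean property. *)
Lemma lub_geometric (r e : C) : 0 <= r < 1 -> 0 < e -> exists n, r ^+ n < e.
Proof.
move=> /andP[r0 r1] e0.
have [r00|rn0] := eqVneq r 0; first by exists 1%N; rewrite r00.
have rp : 0 < r by rewrite lt_def rn0.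
pose d := r^-1 - 1.
have d0 : 0 < d by rewrite subr_gt0 invf_gt1.
have [|n hn] := @lub_archimedean ((e * d)^-1).
  by rewrite invr_ge0 mulr_ge0// ltW.
have bern m : 1 + m%:R * d <= r^-1 ^+ m.
  elim: m => [|m IH]; first by rewrite mul0r addr0.
    rewrite exprS (_ : r^-1 * _ = d * r^-1 ^+ m + r^-1 ^+ m); last by rewrite /d; ring.
  apply: le_trans (_ : d * 1 + (1 + m%:R * d) <= _); last first.
    apply: lerD => //; apply: ler_wpM2l; first exact: ltW.
    by apply: le_trans IH; rewrite lerDl mulr_ge0// ltW.
  by rewrite -natr1 le_eqVlt; apply/orP; left; apply/eqP; ring.
exists n; rewrite -[r]invrK exprVn invf_plt ?posrE ?exprn_gt0 ?invr_gt0//.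
apply: lt_le_trans (bern n); rewrite ltr_wpDl//.
by rewrite -ltr_pdivrMr//; apply: le_lt_trans hn; rewrite invfM.
Qed.

End Lub.

Lemma ex_imaginary (C : numClosedFieldType) :
  exists I : C, I * I = -1 /\ Num.conj I = - I.
Proof. by exists 'i; rewrite -expr2 sqrCi conjCi. Qed.

(** * Square-summable families *)

Definition sqsummable (C : numClosedFieldType) (X : choiceType) (f : X -> C) :=
  exists M : C, forall s, uniq s -> \sum_(x <- s) `|f x| ^+ 2 <= M.

Definition l2_pred (C : numClosedFieldType) (X : choiceType) : {pred X -> C^o} :=
  fun f => `[< sqsummable f >].

(** The proof lubC is a parameter because the norm of the space, and hence the
instances declared on it, are obtained from least upper bounds. *)
Record l2_space (C : numClosedFieldType) (lubC : lub_property C) (X : choiceType) :=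
  L2 { l2_fun :> X -> C^o; _ : l2_fun \in @l2_pred C X }.

Section L2.
Variables (C : numClosedFieldType) (lubC : lub_property C) (X : choiceType).
Local Notation l2_pred := (@l2_pred C X).
Local Notation l2 := (l2_space lubC X).

HB.instance Definition _ := [isSub for @l2_fun C lubC X].
HB.instance Definition _ := [Choice of l2 by <:].

Lemma sqr_normD_le (a b : C) : `|a + b| ^+ 2 <= 2 * (`|a| ^+ 2 + `|b| ^+ 2).
Proof.
apply: le_trans (_ : (`|a| + `|b|) ^+ 2 <= _).
  by rewrite ler_pXn2r ?nnegrE ?addr_ge0// ler_normD.
rewrite -subr_ge0 [leRHS](_ : _ = (`|a| - `|b|) ^+ 2); last by ring.
by rewrite real_exprn_even_ge0// rpredB// normr_real.
Qed.

Lemma sqsummableP (f : l2) : sqsummable f.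
Proof. by case: f => f /= /asboolP. Qed.

Lemma l2_submod : submod_closed l2_pred.
Proof.
split.
  by apply/asboolP; exists 0 => s _; rewrite big1// => x _; rewrite normr0 expr0n.
move=> a f g /asboolP[M hM] /asboolP[N hN]; apply/asboolP.
exists (2 * (`|a| ^+ 2 * M + N)) => s us.
apply: le_trans (_ : \sum_(x <- s) 2 * (`|a| ^+ 2 * `|f x| ^+ 2 + `|g x| ^+ 2) <= _).
  apply: ler_sum => x _; apply: le_trans (sqr_normD_le _ _) _.
  by rewrite normrM exprMn.
rewrite -mulr_sumr big_split /= -mulr_sumr ler_wpM2l// lerD ?hN//.
by rewrite ler_wpM2l ?hM// exprn_ge0.
Qed.

HB.instance Definition _ := GRing.isSubmodClosed.Build _ _ l2_pred l2_submod.
HB.instance Definition _ := [SubChoice_isSubLmodule of l2 by <:].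

Lemma l2_addE (f g : l2) x : (f + g) x = f x + g x. Proof. by []. Qed.
Lemma l2_oppE (f : l2) x : (- f) x = - f x. Proof. by []. Qed.
Lemma l2_scaleE a (f : l2) x : (a *: f) x = a * f x. Proof. by []. Qed.

(** By polarization the summand is a combination of four families of squares,
each of which has bounded partial sums. *)
Lemma l2_has_sum (f g : l2) : exists c, has_sum (fun x => f x * Num.conj (g x)) c.
Proof.
have E (h : l2) : exists c, has_sum (fun x => `|h x| ^+ 2) c.
  have [M hM] := sqsummableP h.
  by apply: (has_sum_exists lubC (M := M)) => // x; rewrite exprn_ge0.
have [I [I2 Ic]] := ex_imaginary C.
have [a ha] := E (f + g); have [b hb] := E (f - g).
have [c hc] := E (f + I *: g); have [d hd] := E (f - I *: g).
(* 4 f g^* = |f+g|^2 - |f-g|^2 + i (|f+ig|^2 - |f-ig|^2) *)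
have h4 := has_sumD (has_sumD ha (has_sumZ (-1) hb))
  (has_sumZ I (has_sumD hc (has_sumZ (-1) hd))).
exists (4^-1 * (a + -1 * b + I * (c + -1 * d))).
move: (has_sumZ 4^-1 h4); apply: eq_has_sum => x; cbv beta.
rewrite !(l2_addE, l2_oppE, l2_scaleE) !normCK !rmorphD !rmorphN /= !rmorphM /= Ic.
set u := f x; set v := g x; set u' := Num.conj u; set v' := Num.conj v.
apply: (@mulfI _ 4); first by rewrite pnatr_eq0.
rewrite mulVKf ?pnatr_eq0//.
transitivity (2 * (u * v' + v * u') - I * I * (2 * (u * v' - v * u'))); first by ring.
by rewrite I2; ring.
Qed.

(** The default 0 of xget is never taken, by [l2_dotP]. *)
Definition l2_dot (f g : l2) : C := xget 0 [set c | has_sum (fun x => f x * Num.conj (g x)) c].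

Lemma l2_dotP (f g : l2) : has_sum (fun x => f x * Num.conj (g x)) (l2_dot f g).
Proof.
have [c hc] := l2_has_sum f g.
exact: (xgetPex 0 (P := [set c | has_sum (fun x => f x * Num.conj (g x)) c]) (ex_intro _ c hc)).
Qed.

Lemma l2_dot_linl a (f g h : l2) : l2_dot (a *: f + g) h = a * l2_dot f h + l2_dot g h.
Proof.
apply: has_sum_unique (l2_dotP _ _) _.
move: (has_sumD (has_sumZ a (l2_dotP f h)) (l2_dotP g h)).
by apply: eq_has_sum => x /=; rewrite mulrA -mulrDl.
Qed.

Lemma l2_dot_conj (f g : l2) : l2_dot g f = Num.conj (l2_dot f g).
Proof.
apply: has_sum_unique (l2_dotP _ _) _.
move: (has_sum_conj (l2_dotP f g)).
by apply: eq_has_sum => x /=; rewrite rmorphM /= conjCK mulrC.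
Qed.

Lemma l2_dot_sqP (f : l2) : has_sum (fun x => `|f x| ^+ 2) (l2_dot f f).
Proof. by move: (l2_dotP f f); apply: eq_has_sum => x; rewrite normCK. Qed.

Lemma l2_sum_le_dot (f : l2) s : uniq s -> \sum_(x <- s) `|f x| ^+ 2 <= l2_dot f f.
Proof. by apply: has_sum_ub (l2_dot_sqP f) => x; rewrite exprn_ge0. Qed.

Lemma l2_dot_ge0 f : 0 <= l2_dot f f.
Proof. by have := l2_sum_le_dot f (isT : uniq [::]); rewrite big_nil. Qed.

Lemma l2_dot_gt0 f : f != 0 -> 0 < l2_dot f f.
Proof.
move=> f0; rewrite lt_def l2_dot_ge0 andbT; apply: contra_neq f0 => f0.
apply/val_inj/funext => x /=; apply/eqP; rewrite -normr_eq0 -sqrf_eq0.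
rewrite eq_le exprn_ge0// andbT -f0.
by have := l2_sum_le_dot f (isT : uniq [:: x]); rewrite big_seq1.
Qed.

Lemma l2_dot_sesq : (forall f, zmod_morphism (l2_dot^~ f)) * (forall f, zmod_morphism (l2_dot f)).
Proof.
have H f : zmod_morphism (l2_dot^~ f).
  by move=> g h; rewrite -scaleN1r addrC l2_dot_linl mulN1r addrC.
by split=> // f g h; rewrite (l2_dot_conj (g - h) f) (l2_dot_conj g f) (l2_dot_conj h f) H rmorphB.
Qed.

Lemma l2_dot_scal : (forall f, scalable_for *%R (l2_dot^~ f)) *
  (forall f, scalable_for (Num.conj \; *%R) (l2_dot f)).
Proof.
have H f : scalable_for *%R (l2_dot^~ f).
  have z : l2_dot 0 f = 0 by rewrite -[X in l2_dot X](subrr f) l2_dot_sesq.1 subrr.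
  by move=> a g; rewrite -[X in l2_dot X]addr0 l2_dot_linl z addr0.
by split=> // f a g; rewrite (l2_dot_conj (a *: g) f) (l2_dot_conj g f) H rmorphM.
Qed.

HB.instance Definition _ := @isBilinear.Build C l2 l2 C *%R (Num.conj \; *%R) l2_dot
  l2_dot_sesq.1 l2_dot_sesq.2 l2_dot_scal.1 l2_dot_scal.2.

Lemma l2_dot_herm (f g : l2) : l2_dot f g = (-1) ^+ false * Num.conj (l2_dot g f).
Proof. by rewrite expr0 mul1r -l2_dot_conj. Qed.

HB.instance Definition _ := @isHermitianSesquilinear.Build C l2 false Num.conj l2_dot l2_dot_herm.
HB.instance Definition _ := @isDotProduct.Build C l2 l2_dot l2_dot_gt0.

Definition l2_norm (f : l2) : C := sqrtC (l2_dot f f).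

Lemma l2_normD f g : l2_norm (f + g) <= l2_norm f + l2_norm g.
Proof. by apply: pform_triangle l2_dot_linl _ l2_dot_ge0 _ _ => f' g'; rewrite l2_dot_conj. Qed.

Lemma l2_normZ (a : C) f : l2_norm (a *: f) = `|a| * l2_norm f.
Proof.
rewrite /l2_norm l2_dot_scal.1 l2_dot_scal.2 /= mulrA -normCK.
by rewrite sqrtCM ?nnegrE ?exprn_ge0// ?l2_dot_ge0// sqrCK.
Qed.

Lemma l2_norm0_eq0 f : l2_norm f = 0 -> f = 0.
Proof.
move=> /eqP; rewrite sqrtC_eq0 => /eqP f0; apply: contra_eq f0 => /l2_dot_gt0.
by rewrite lt0r => /andP[].
Qed.

HB.instance Definition _ := Lmodule_isNormed.Build C l2 l2_normD l2_normZ l2_norm0_eq0.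

Lemma l2_norm_sq (f : l2) : `|f| ^+ 2 = l2_dot f f.
Proof. by rewrite sqrtCK. Qed.

Lemma l2_norm_le (f : l2) (e : C) : 0 <= e ->
  (forall s, uniq s -> \sum_(x <- s) `|f x| ^+ 2 <= e ^+ 2) -> `|f| <= e.
Proof.
move=> e0 h; rewrite -(@ler_pXn2r _ 2) ?nnegrE// l2_norm_sq.
by apply: has_sum_le (l2_dot_sqP f) h => x; rewrite exprn_ge0.
Qed.

Lemma l2_sum_le_norm (f : l2) s : uniq s -> \sum_(x <- s) `|f x| ^+ 2 <= `|f| ^+ 2.
Proof. by move=> us; rewrite l2_norm_sq l2_sum_le_dot. Qed.

Lemma l2_eval_le (f : l2) x : `|f x| <= `|f|.
Proof.
rewrite -(@ler_pXn2r _ 2) ?nnegrE//.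
by have := l2_sum_le_norm f (isT : uniq [:: x]); rewrite big_seq1.
Qed.
End L2.

(** * Completeness of l2 *)

Lemma cauchy_small_sets (C : numFieldType) (V : normedModType C) (F : set_system V) (e : C) :
  ProperFilter F -> cauchy F -> 0 < e ->
  exists A, F A /\ forall f g, A f -> A g -> `|f - g| <= e.
Proof.
move=> FF Fc e0; have e2 : 0 < e / 2 by rewrite divr_gt0.
have /cauchyP/(_ _ e2)[f Ff] := Fc; exists (ball f (e / 2)); split=> // g g' a b.
by have := ball_triangle (ball_sym a) b; rewrite -splitr -ball_normE /= => /ltW.
Qed.

(** A Cauchy filter has small sets, so a point v at distance at most e from every
set of diameter e in the filter is its limit. This reduces completeness of the
spaces below to finding pointwise limits. *)
Lemma cvg_of_diam (C : numFieldType) (V : normedModType C) (F : set_system V) (v : V) :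
  ProperFilter F -> cauchy F ->
  (forall (A : set V) (e : C), F A -> 0 < e ->
     (forall f g, A f -> A g -> `|f - g| <= e) ->
     forall f, A f -> `|f - v| <= e) -> cvg F.
Proof.
move=> FF Fc h; apply/cvg_ex; exists v; apply/cvgrPdist_le => e e0.
have [A [FA hA]] := cauchy_small_sets FF Fc e0.
by apply: filterS (FA) => f Af; rewrite distrC; exact: (h A e FA e0 hA f Af).
Qed.

Lemma norm_Re_le (C : numClosedFieldType) (x : C) : `|'Re x| <= `|x|.
Proof. by have [] := leif_normC_Re_Creal x. Qed.

Lemma norm_Im_le (C : numClosedFieldType) (x : C) : `|'Im x| <= `|x|.
Proof.
have -> : 'Im x = 'Re (- 'i * x).
  have -> : - 'i * x = 'Im x + 'i * (- 'Re x).
    rewrite [in LHS](Crect x).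
    transitivity (- ('i ^+ 2) * 'Im x + 'i * (- 'Re x)); first by ring.
    by rewrite sqrCi; ring.
  by rewrite Re_rect ?rpredN ?Creal_Re ?Creal_Im.
by apply: le_trans (norm_Re_le _) _; rewrite normrM normrN normCi mul1r.
Qed.

Section CauchyScalars.
Variables (C : numClosedFieldType) (lubC : lub_property C).
Variables (T : Type) (F : set_system T) (FF : ProperFilter F).

(** The limit is the least upper bound of the numbers that are eventually below
phi; adding 1 - phi f1 makes phi nonnegative on a set of the filter. *)
Lemma real_cauchy_limit (phi : T -> C) : (forall f, phi f \is Num.real) ->
  (exists A, F A /\ forall f g, A f -> A g -> `|phi f - phi g| <= 1) ->
  exists2 c, c \is Num.real &
    forall (A : set T) (e : C), F A -> 0 < e ->
     (forall f g, A f -> A g -> `|phi f - phi g| <= e) ->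
     forall f, A f -> `|phi f - c| <= e.
Proof.
move=> rphi [A1 [FA1 h1]]; have [f1 Af1] := filter_ex FA1.
pose psi f := phi f - phi f1 + 1.
have rpsi f : psi f \is Num.real by apply: realD; [apply: realB|exact: real1].
have psiE f g : psi f - psi g = phi f - phi g by rewrite /psi; ring.
pose S := [set x | 0 <= x /\ exists A, F A /\ forall f, A f -> x <= psi f].
have [||c [ub lb]] := lubC (S := S) (M := 2).
- exists 0; split=> //; exists A1; split=> // f /(h1 _ _ Af1).
  rewrite distrC real_ler_norml ?rpredB// => /andP[h _].
  by rewrite -lerBlDr sub0r.
- move=> x [x0 [A [FA hA]]]; rewrite x0 /=.
  have [f [Af A1f]] := filter_ex (filterI FA FA1).
  apply: le_trans (hA _ Af) _; rewrite /psi -[leRHS]/(1 + 1) lerD2r.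
  by have := h1 _ _ A1f Af1; rewrite real_ler_norml ?rpredB// => /andP[].
have c0 : 0 <= c.
  apply: ub; split=> //; exists A1; split=> // f /(h1 _ _ Af1).
  rewrite distrC real_ler_norml ?rpredB// => /andP[h _].
  by rewrite -lerBlDr sub0r.
have rc : c \is Num.real by exact: ger0_real.
exists (c + phi f1 - 1); first by apply: realB; [exact: realD|exact: real1].
move=> A e FA e0 hA f Af.
have re : e \is Num.real by rewrite gtr0_real.
have -> : phi f - (c + phi f1 - 1) = psi f - c by rewrite /psi; ring.
rewrite real_ler_norml ?rpredB//; apply/andP; split.
  rewrite lerBrDr addrC lerBlDr; apply: lb => x [x0 [A' [FA' hA']]].
  have [g [Ag A'g]] := filter_ex (filterI FA FA').
  apply: le_trans (hA' _ A'g) _; rewrite -lerBlDl psiE.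
  by have := hA _ _ Ag Af; rewrite real_ler_norml ?rpredB// => /andP[].
rewrite lerBlDr -lerBlDl.
have [|h] := real_leP (realB (rpsi f) re) (real0 C).
  by move=> /le_trans; apply.
apply: ub; split; first exact: ltW.
exists A; split=> // g Ag; rewrite lerBlDr -lerBlDl psiE.
by have := hA _ _ Af Ag; rewrite real_ler_norml ?rpredB// => /andP[].
Qed.

Lemma cauchy_limit (phi : T -> C) :
  (forall e, 0 < e -> exists A, F A /\ forall f g, A f -> A g -> `|phi f - phi g| <= e) ->
  exists c, forall e, 0 < e -> exists A, F A /\ forall f, A f -> `|phi f - c| <= e.
Proof.
move=> hc.
have [A1 [FA1 h1]] := hc _ (@ltr01 C).
have [||a ra ha] := @real_cauchy_limit (fun f => 'Re (phi f)).
- by move=> f; exact: Creal_Re.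
- exists A1; split=> // f g Af Ag; apply: le_trans (h1 _ _ Af Ag).
  by rewrite -raddfB norm_Re_le.
have [||b rb hb] := @real_cauchy_limit (fun f => 'Im (phi f)).
- by move=> f; exact: Creal_Im.
- exists A1; split=> // f g Af Ag; apply: le_trans (h1 _ _ Af Ag).
  by rewrite -raddfB norm_Im_le.
exists (a + 'i * b) => e e0.
have e2 : 0 < e / 2 by rewrite divr_gt0.
have [A [FA hA]] := hc _ e2; exists A; split=> // f Af.
rewrite [phi f]Crect opprD addrACA -mulrBr (splitr e).
apply: le_trans (ler_normD _ _) _; rewrite normrM normCi mul1r lerD//.
  apply: (ha _ _ FA e2) => // f' g' Af' Ag'; apply: le_trans (hA _ _ Af' Ag').
  by rewrite -raddfB norm_Re_le.
apply: (hb _ _ FA e2) => // f' g' Af' Ag'; apply: le_trans (hA _ _ Af' Ag').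
by rewrite -raddfB norm_Im_le.
Qed.
End CauchyScalars.

Section L2Complete.
Variables (C : numClosedFieldType) (lubC : lub_property C) (X : choiceType).
Local Notation l2 := (l2_space lubC X).

(** Finite intersections of filter sets give a common neighbourhood for finitely
many coordinates. *)
Lemma near_finite (F : set_system l2) (FF : ProperFilter F) (v : X -> C) :
  (forall x e, 0 < e -> exists A, F A /\ forall f, A f -> `|f x - v x| <= e) ->
  forall (s : seq X) e, 0 < e -> exists A, F A /\ forall f x, A f -> x \in s -> `|f x - v x| <= e.
Proof.
move=> h s e e0; elim: s => [|x s [A [FA hA]]].
  by exists setT; split=> //; exact: filterT.
have [B [FB hB]] := h x e e0; exists (A `&` B); split; first exact: filterI.
move=> f y [Af Bf]; rewrite inE => /orP[/eqP ->|ys]; first exact: hB.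
exact: hA.
Qed.

Lemma l2_complete (F : set_system l2) : ProperFilter F -> cauchy F -> cvg F.
Proof.
move=> FF Fc.
have diam e := @cauchy_small_sets _ _ F e FF Fc.
have pw x : exists c, forall e, 0 < e -> exists A, F A /\ forall f : l2, A f -> `|f x - c| <= e.
  apply: (cauchy_limit lubC FF) => e /diam[A [FA hA]]; exists A; split=> // f g Af Ag.
  apply: le_trans (hA _ _ Af Ag); apply: (l2_eval_le (f - g) x).
have /choice[v hv] := pw.
have bd (A : set l2) (e : C) : F A -> 0 < e ->
     (forall f g, A f -> A g -> `|f - g| <= e) ->
     forall f, A f -> forall s, uniq s -> \sum_(x <- s) `|f x - v x| ^+ 2 <= e ^+ 2.
  move=> FA e0 hA f Af s us; apply/ler_addgt0Pr => eta eta0.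
  (* The tolerance eta / D leaves room for the size s cross terms 2 e d + d ^+ 2. *)
  pose D := (size s)%:R * (2 * e + 1) + 1 + eta.
  have s0 : 0 <= (size s)%:R * (2 * e + 1) :> C.
    by rewrite mulr_ge0// addr_ge0// mulr_ge0// ltW.
  have D0 : 0 < D by rewrite /D -addrA ltr_wpDl// addr_gt0.
  have d0 : 0 < eta / D by rewrite divr_gt0.
  have d1 : eta / D <= 1 by rewrite ler_pdivrMr// mul1r /D lerDr ltW// ltr_wpDl.
  have [B [FB hB]] := near_finite FF hv s d0.
  have [g [Ag Bg]] := filter_ex (filterI FA FB).
  set d := eta / D in d0 d1 hB *.
  apply: le_trans (_ : \sum_(x <- s) (`|(f - g) x| ^+ 2 + d * (2 * e + 1)) <= _).
    rewrite big_seq [leRHS]big_seq; apply: ler_sum => x xs.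
    have h1 : `|f x - v x| <= `|(f - g) x| + d.
      apply: le_trans (ler_distD (g x) _ _) _.
      by rewrite lerD2l hB.
    apply: le_trans (_ : (`|(f - g) x| + d) ^+ 2 <= _).
      by rewrite ler_pXn2r ?nnegrE// addr_ge0// ltW.
    rewrite sqrrD -addrA lerD2l.
    have h2 : `|(f - g) x| <= e by apply: le_trans (l2_eval_le _ x) (hA _ _ Af Ag).
    rewrite [leRHS]mulrDr mulr1 -mulr_natl mulrA [d * _]mulrC.
    apply: lerD; last by rewrite expr2 ler_piMr// ltW.
    by rewrite (ler_wpM2r (ltW d0))// ler_wpM2l.
  rewrite big_split /=; apply: lerD.
    apply: le_trans (l2_sum_le_norm (f - g) us) _.
    by rewrite ler_pXn2r ?nnegrE ?(ltW e0)//; exact: hA.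
  rewrite big_const_seq count_predT iter_addr_0 -[_ *+ size s]mulr_natl mulrCA.
  rewrite /d mulrAC ler_pdivrMr// (ler_wpM2l (ltW eta0))// /D -addrA lerDl.
  by rewrite addr_ge0// ltW.
have [A1 [FA1 h1]] := diam _ (@ltr01 C).
have [f1 Af1] := filter_ex FA1.
have vl2 : (v : X -> C^o) \in @l2_pred C X.
  have -> : v = (f1 : X -> C^o) - ((f1 : X -> C^o) - v).
    by apply/funext => x /=; rewrite !fctE subKr.
  rewrite rpredB//; first exact: valP.
  apply/asboolP; exists 1 => s us; apply: le_trans (bd _ _ FA1 ltr01 h1 _ Af1 s us) _.
  by rewrite expr1n.
apply: (@cvg_of_diam _ _ F (L2 lubC vl2)) => // A e FA e0 hA f Af.
apply: l2_norm_le; first exact: ltW.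
by move=> s us; exact: (bd A).
Qed.

HB.instance Definition _ := Uniform_isComplete.Build l2 l2_complete.
HB.instance Definition _ := isHilbert.Build C l2 (@l2_norm_sq C lubC X).
End L2Complete.

(** * The C*-algebra of bounded operators *)

Section HilbertBasics.
Variables (C : numClosedFieldType) (H : hilbertType C).
Implicit Types x y z : H.

Lemma hdot_conj x y : hdot y x = Num.conj (hdot x y).
Proof. by have := @hermitian_subproof _ _ _ _ (hdot (H := H)) y x; rewrite expr0 mul1r. Qed.

Lemma hdot_linl (a : C) x y z : hdot (a *: x + y) z = a * hdot x z + hdot y z.
Proof. by rewrite linearDl linearZl_LR. Qed.

Lemma hdot_ge0 x : 0 <= hdot x x.
Proof. by rewrite -hdot_norm exprn_ge0. Qed.

Lemma hdotDl x y z : hdot (x + y) z = hdot x z + hdot y z.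
Proof. exact: (pform_lD hdot_linl). Qed.
Lemma hdotZl a x z : hdot (a *: x) z = a * hdot x z.
Proof. exact: (pform_lZ hdot_linl). Qed.
Lemma hdot0l z : hdot 0 z = 0.
Proof. exact: (pform_l0 hdot_linl). Qed.
Lemma hdotDr x y z : hdot z (x + y) = hdot z x + hdot z y.
Proof. exact: (pform_rD hdot_linl hdot_conj). Qed.
Lemma hdotZr a x z : hdot z (a *: x) = Num.conj a * hdot z x.
Proof. exact: (pform_rZ hdot_linl hdot_conj). Qed.
Lemma hdot0r z : hdot z 0 = 0.
Proof. by rewrite hdot_conj hdot0l rmorph0. Qed.
Lemma hdotNl x z : hdot (- x) z = - hdot x z.
Proof. by rewrite -scaleN1r hdotZl mulN1r. Qed.
Lemma hdotBl x y z : hdot (x - y) z = hdot x z - hdot y z.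
Proof. by rewrite hdotDl hdotNl. Qed.
Lemma hdotBr x y z : hdot z (x - y) = hdot z x - hdot z y.
Proof. by rewrite hdotDr -scaleN1r hdotZr rmorphN rmorph1 mulN1r. Qed.

Lemma hdot_CS x y : `|hdot x y| <= `|x| * `|y|.
Proof.
rewrite -(@ler_pXn2r _ 2) ?nnegrE ?mulr_ge0// exprMn !hdot_norm.
exact: (pform_CS hdot_linl hdot_conj hdot_ge0).
Qed.

Lemma hdot_ext x y : (forall z, hdot x z = hdot y z) -> x = y.
Proof.
move=> h; apply/eqP; rewrite -subr_eq0 -normr_eq0 -sqrf_eq0 hdot_norm hdotBl.
by rewrite h subrr.
Qed.

Lemma hdot_extr x y : (forall z, hdot z x = hdot z y) -> x = y.
Proof. by move=> h; apply: hdot_ext => z; rewrite hdot_conj h -hdot_conj. Qed.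
End HilbertBasics.

(** The adjoint is part of the definition, which makes the involution available
at once and implies linearity. *)
Definition adjointable (C : numClosedFieldType) (H : hilbertType C) (f : H -> H) :=
  (exists g, forall x y, hdot (f x) y = hdot x (g y)) /\
  exists2 M : C, 0 <= M & forall x, `|f x| <= M * `|x|.

Definition bop_pred (C : numClosedFieldType) (H : hilbertType C) : {pred H -> H} :=
  fun f => `[< adjointable f >].

Record bounded_op (C : numClosedFieldType) (lubC : lub_property C) (H : hilbertType C) :=
  BOp { op_fun :> H -> H; _ : op_fun \in @bop_pred C H }.

Section BoundedOperators.
Variables (C : numClosedFieldType) (lubC : lub_property C) (H : hilbertType C).
Local Notation bop_pred := (@bop_pred C H).
Local Notation bop := (bounded_op lubC H).

HB.instance Definition _ := [isSub for @op_fun C lubC H].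
HB.instance Definition _ := [Choice of bop by <:].

Lemma bop_submod : submod_closed bop_pred.
Proof.
split.
  apply/asboolP; split; first by exists (fun=> 0) => x y; rewrite hdot0l hdot0r.
  by exists 0 => // x; rewrite normr0 mul0r.
move=> a f g /asboolP[[f' hf] [M M0 hM]] /asboolP[[g' hg] [N N0 hN]]; apply/asboolP; split.
  exists (fun y => Num.conj a *: f' y + g' y) => x y.
  by rewrite [LHS]hdot_linl hf hg hdotDr hdotZr conjCK.
exists (`|a| * M + N); first by rewrite addr_ge0// mulr_ge0.
move=> x; rewrite mulrDl; apply: le_trans (ler_normD _ _) _.
by rewrite normrZ -mulrA lerD// ler_wpM2l.
Qed.

HB.instance Definition _ := GRing.isSubmodClosed.Build _ _ bop_pred bop_submod.
HB.instance Definition _ := [SubChoice_isSubLmodule of bop by <:].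

Lemma op_addE (f g : bop) x : (f + g) x = f x + g x. Proof. by []. Qed.
Lemma op_oppE (f : bop) x : (- f) x = - f x. Proof. by []. Qed.
Lemma op_scaleE a (f : bop) x : (a *: f) x = a *: f x. Proof. by []. Qed.
Lemma op_ext (f g : bop) : (forall x, f x = g x) -> f = g.
Proof. by move=> h; apply/val_inj/funext. Qed.

Lemma opP (f : bop) : adjointable f.
Proof. by case: f => f /= /asboolP. Qed.

Lemma adjointable_linear (f : H -> H) : (exists g, forall x y, hdot (f x) y = hdot x (g y)) ->
  linear f.
Proof.
move=> [g hg] a x y; apply: hdot_ext => z.
by rewrite hg !hdot_linl !hg.
Qed.

Lemma op_linear (f : bop) : linear f.
Proof. exact: adjointable_linear (opP f).1. Qed.

Lemma opZ (f : bop) a x : f (a *: x) = a *: f x.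
Proof.
have f0 : f 0 = 0 by have := op_linear f (-1) 0 0; rewrite scaleN1r oppr0 addr0 scaleN1r addNr.
by rewrite -[a *: x]addr0 op_linear f0 addr0.
Qed.

Lemma opD (f : bop) x y : f (x + y) = f x + f y.
Proof. by rewrite -[x]scale1r op_linear !scale1r. Qed.

Lemma op0 (f : bop) : f 0 = 0.
Proof. by rewrite -(scale0r (0 : H)) opZ !scale0r. Qed.

Definition op_norm_spec (f : H -> H) (c : C) :=
  (forall x, `|x| <= 1 -> `|f x| <= c) /\
  forall b, (forall x, `|x| <= 1 -> `|f x| <= b) -> c <= b.

(** The default 0 of xget is never taken, by [op_normP]. *)
Definition op_norm (f : bop) : C := xget 0 [set c | op_norm_spec f c].

Lemma op_normP (f : bop) : op_norm_spec f (op_norm f).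
Proof.
suff [c hc] : exists c, op_norm_spec f c.
  by apply: (xgetPex 0 (P := [set c | op_norm_spec f c])); exists c.
have [_ [M M0 hM]] := opP f.
have [||c [ub lb]] := lubC (S := [set `|f x| | x in [set x | `|x| <= 1]]) (M := M).
- by exists `|f 0|, 0 => //=; rewrite normr0.
- move=> _ [x /= x1 <-]; rewrite normr_ge0 /=.
  by apply: le_trans (hM x) _; rewrite ler_piMr.
exists c; split=> [x x1|b hb]; first by apply: ub; exists x.
by apply: lb => _ [x /= x1 <-]; exact: hb.
Qed.

Lemma op_norm_ge0 f : 0 <= op_norm f.
Proof. by apply: le_trans ((op_normP f).1 0 _); rewrite ?normr0. Qed.

Lemma op_norm_bound (f : bop) x : `|f x| <= op_norm f * `|x|.
Proof.
have [->|x0] := eqVneq x 0; first by rewrite op0 !normr0 mulr0.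
have nx : 0 < `|x| by rewrite normr_gt0.
rewrite -ler_pdivrMr// mulrC; have := (op_normP f).1 (`|x|^-1 *: x).
rewrite opZ !normrZ !normfV !normr_id; apply.
by rewrite mulVf// gt_eqF.
Qed.

Lemma op_norm_least (f : bop) b : 0 <= b -> (forall x, `|f x| <= b * `|x|) -> op_norm f <= b.
Proof.
move=> b0 h; apply: (op_normP f).2 => x x1.
by apply: le_trans (h x) _; rewrite ler_piMr.
Qed.

Lemma op_normD f g : op_norm (f + g) <= op_norm f + op_norm g.
Proof.
apply: op_norm_least => [|x]; first by rewrite addr_ge0// op_norm_ge0.
rewrite mulrDl op_addE; apply: le_trans (ler_normD _ _) _.
by rewrite lerD// op_norm_bound.
Qed.

Lemma op_normZ (a : C) f : op_norm (a *: f) = `|a| * op_norm f.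
Proof.
have le b g : op_norm (b *: g) <= `|b| * op_norm g.
  apply: op_norm_least => [|x]; first by rewrite mulr_ge0// op_norm_ge0.
  by rewrite op_scaleE normrZ -mulrA ler_wpM2l// op_norm_bound.
apply/eqP; rewrite eq_le le /=.
have [->|a0] := eqVneq a 0; first by rewrite normr0 mul0r op_norm_ge0.
have := le a^-1 (a *: f); rewrite scalerA mulVf// scale1r normfV.
by rewrite ler_pdivlMl// normr_gt0.
Qed.

Lemma op_norm0_eq0 f : op_norm f = 0 -> f = 0.
Proof.
move=> f0; apply: op_ext => x; apply/eqP; rewrite -normr_le0.
by have := op_norm_bound f x; rewrite f0 mul0r.
Qed.

HB.instance Definition _ := Lmodule_isNormed.Build C bop op_normD op_normZ op_norm0_eq0.

Lemma op_le (f : bop) x : `|f x| <= `|f| * `|x|.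
Proof. exact: op_norm_bound. Qed.

Lemma op_norm_le (f : bop) b : 0 <= b -> (forall x, `|f x| <= b * `|x|) -> `|f| <= b.
Proof. exact: op_norm_least. Qed.

Lemma adjoint_exists (f : bop) : exists g : bop, forall x y, hdot (f x) y = hdot x (g y).
Proof.
have [[g hg] [M M0 hM]] := opP f.
suff gP : (g : H -> H) \in bop_pred by exists (BOp lubC gP).
apply/asboolP; split.
  by exists f => x y; rewrite hdot_conj -hg -hdot_conj.
exists M => // y.
have [->|gy] := eqVneq (g y) 0; first by rewrite normr0 mulr_ge0.
have ny : 0 < `|g y| by rewrite normr_gt0.
rewrite -(ler_pM2r ny) -expr2 hdot_norm -hg.
rewrite -[leLHS]ger0_norm; last by rewrite hg hdot_ge0.
apply: le_trans (hdot_CS _ _) _.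
by rewrite mulrAC ler_wpM2r.
Qed.

Definition op_adj (f : bop) : bop := sval (cid (adjoint_exists f)).

Lemma op_adjP (f : bop) x y : hdot (f x) y = hdot x (op_adj f y).
Proof. by rewrite /op_adj; case: cid => g /= ->. Qed.

Lemma op_adjPr (f : bop) x y : hdot (op_adj f x) y = hdot x (f y).
Proof. by rewrite hdot_conj -op_adjP -hdot_conj. Qed.

Lemma op_adj_unique (f g : bop) : (forall x y, hdot (f x) y = hdot x (g y)) -> op_adj f = g.
Proof. by move=> h; apply: op_ext => y; apply: hdot_extr => x; rewrite -op_adjP h. Qed.

Lemma op_idP : (idfun : H -> H) \in bop_pred.
Proof.
by apply/asboolP; split; [exists idfun|exists 1 => // x; rewrite mul1r].
Qed.

Lemma op_compP (f g : bop) : (f \o g : H -> H) \in bop_pred.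
Proof.
apply/asboolP; split.
  by exists (op_adj g \o op_adj f) => x y /=; rewrite !op_adjP.
exists (`|f| * `|g|); first by rewrite mulr_ge0.
move=> x /=; apply: le_trans (op_le _ _) _.
by rewrite -mulrA ler_wpM2l// op_le.
Qed.

Definition op_id : bop := BOp lubC op_idP.
Definition op_comp (f g : bop) : bop := BOp lubC (op_compP f g).

Lemma op_adj_norm (f : bop) : `|op_adj f| <= `|f|.
Proof.
apply: op_norm_le => // y.
have [->|gy] := eqVneq (op_adj f y) 0; first by rewrite normr0 mulr_ge0.
have ny : 0 < `|op_adj f y| by rewrite normr_gt0.
rewrite -(ler_pM2r ny) -expr2 hdot_norm -op_adjP.
rewrite -[leLHS]ger0_norm; last by rewrite op_adjP hdot_ge0.
apply: le_trans (hdot_CS _ _) _.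
by rewrite mulrAC ler_wpM2r// op_le.
Qed.

Lemma op_comp_norm (f g : bop) : `|op_comp f g| <= `|f| * `|g|.
Proof.
apply: op_norm_le => [|x]; first by rewrite mulr_ge0.
by apply: le_trans (op_le f (g x)) _; rewrite -mulrA ler_wpM2l// op_le.
Qed.

Lemma op_adjK : involutive op_adj.
Proof. by move=> f; apply: op_adj_unique => x y; rewrite op_adjPr. Qed.

Lemma op_cstar (f : bop) : `|op_comp (op_adj f) f| = `|f| ^+ 2.
Proof.
apply/eqP; rewrite eq_le; apply/andP; split.
  apply: le_trans (op_comp_norm _ _) _; rewrite expr2 ler_wpM2r//.
  exact: op_adj_norm.
rewrite -[leRHS]sqrtCK ler_pXn2r ?nnegrE ?sqrtC_ge0//.
apply: op_norm_le => [|x]; first by rewrite sqrtC_ge0.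
rewrite -(@ler_pXn2r _ 2) ?nnegrE ?mulr_ge0 ?sqrtC_ge0// exprMn sqrtCK hdot_norm op_adjP.
rewrite -[leLHS]ger0_norm; last by rewrite -op_adjP hdot_ge0.
apply: le_trans (hdot_CS _ _) _; rewrite mulrC expr2 mulrA ler_wpM2r//.
exact: (op_le (op_comp (op_adj f) f)).
Qed.

(** Along a Cauchy filter of operators both the operators and their adjoints have
pointwise limits, because taking adjoints does not increase norms; the two limit
maps are adjoint to each other. *)
Lemma op_complete (F : set_system bop) : ProperFilter F -> cauchy F -> cvg F.
Proof.
move=> FF Fc.
have diam e := @cauchy_small_sets _ _ F e FF Fc.
have pw (T : bop -> H) (M : C) : 0 <= M -> (forall f g, `|T f - T g| <= M * `|f - g|) ->
    exists v, forall e, 0 < e -> exists A, F A /\ forall f : bop, A f -> `|T f - v| <= e.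
  move=> M0 hT.
  have Tc : cauchy (T @ F).
    apply/cauchyP => e e0.
    have M1 : 0 < M + 1 by rewrite ltr_wpDl.
    have [A [FA hA]] := diam _ (divr_gt0 e0 M1).
    have [f Af] := filter_ex FA; exists (T f).
    have hg g : A g -> ball (T f) e (T g); last exact: filterS hg FA.
    move=> Ag; rewrite -ball_normE /=; apply: le_lt_trans (hT _ _) _.
    apply: le_lt_trans (_ : M * (e / (M + 1)) < _); first by rewrite ler_wpM2l// hA.
    by rewrite mulrA ltr_pdivrMr// mulrC ltr_pM2l// ltrDl.
  have hv : T @ F --> lim (T @ F) by exact: cauchy_cvg.
  move/cvgrPdist_le: hv => hv.
  exists (lim (T @ F)) => e e0; have FA := hv e e0.
  by exists [set f | `|lim (T @ F) - T f| <= e]; split=> // f /=; rewrite distrC.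
have pw1 x : exists v, forall e, 0 < e ->
    exists A, F A /\ forall f : bop, A f -> `|f x - v| <= e.
  by apply: (pw (fun f => f x) `|x|) => // f g; rewrite mulrC (op_le (f - g) x).
have adjB (f g : bop) : op_adj f - op_adj g = op_adj (f - g).
  symmetry; apply: op_adj_unique => x y; rewrite op_addE op_oppE hdotBl.
  by rewrite op_addE op_oppE hdotBr !op_adjP.
have pw2 x : exists v, forall e, 0 < e ->
    exists A, F A /\ forall f : bop, A f -> `|op_adj f x - v| <= e.
  apply: (pw (fun f => op_adj f x) `|x|) => // f g.
  have -> : op_adj f x - op_adj g x = (op_adj f - op_adj g) x by [].
  rewrite adjB mulrC; apply: le_trans (op_le _ _) _; rewrite ler_wpM2r//.
  exact: op_adj_norm.
have {pw1}/choice[v hv] := pw1; have {pw2}/choice[v' hv'] := pw2.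
have bd (A : set bop) (e : C) : F A -> 0 < e ->
     (forall f g, A f -> A g -> `|f - g| <= e) ->
     forall f, A f -> forall x, `|f x - v x| <= e * `|x|.
  move=> FA e0 hA f Af x; apply/ler_addgt0Pr => d d0.
  have [B [FB hB]] := hv x d d0.
  have [g [Ag Bg]] := filter_ex (filterI FA FB).
  apply: le_trans (ler_distD (g x) _ _) _; apply: lerD; last exact: hB.
  by apply: le_trans (op_le (f - g) x) _; rewrite ler_wpM2r// hA.
have [A1 [FA1 h1]] := diam _ (@ltr01 C).
have [f1 Af1] := filter_ex FA1.
have vP : (v : H -> H) \in bop_pred.
  apply/asboolP; split.
    exists v' => x y; apply/eqP; rewrite -subr_eq0 -normr_le0.
    apply/ler_addgt0Pr => e e0; rewrite add0r.
    pose M := `|y| + `|x| + 1.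
    have M0 : 0 < M by rewrite ltr_wpDl// addr_ge0.
    have d0 := divr_gt0 e0 M0.
    have [A [FA hA]] := hv x _ d0; have [B [FB hB]] := hv' y _ d0.
    have [f [Af Bf]] := filter_ex (filterI FA FB).
    have -> : hdot (v x) y - hdot x (v' y) = hdot x (op_adj f y - v' y) - hdot (f x - v x) y.
      by rewrite hdotBr hdotBl -op_adjP; ring.
    apply: le_trans (ler_normB _ _) _.
    apply: le_trans (_ : `|x| * (e / M) + (e / M) * `|y| <= _).
      apply: lerD; apply: le_trans (hdot_CS _ _) _.
        by rewrite ler_wpM2l// hB.
      by rewrite ler_wpM2r// hA.
    rewrite [_ * `|y|]mulrC -mulrDl mulrCA (ler_piMr (ltW e0))// ler_pdivrMr// mul1r /M.
    by rewrite [`|y| + _]addrC lerDl.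
  exists (`|f1| + 1); first by rewrite addr_ge0.
  move=> x; rewrite -[v x](subKr (f1 x)) mulrDl.
  apply: le_trans (ler_normB _ _) _; apply: lerD; first exact: op_le.
  exact: (bd A1).
apply: (@cvg_of_diam _ _ F (BOp lubC vP)) => // A e FA e0 hA f Af.
apply: op_norm_le; first exact: ltW.
exact: (bd A).
Qed.

HB.instance Definition _ := Uniform_isComplete.Build bop op_complete.

Lemma op_compA : associative op_comp. Proof. by move=> f g h; apply: op_ext. Qed.
Lemma op_comp1x : left_id op_id op_comp. Proof. by move=> f; apply: op_ext. Qed.
Lemma op_compx1 : right_id op_id op_comp. Proof. by move=> f; apply: op_ext. Qed.
Lemma op_comp_linl (g : bop) : linear (op_comp^~ g).
Proof. by move=> a f h; apply: op_ext. Qed.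
Lemma op_comp_linr (g : bop) : linear (op_comp g).
Proof. by move=> a f h; apply: op_ext => x /=; rewrite opD opZ. Qed.
Lemma op_adj_antilinear (a : C) (f g : bop) :
  op_adj (a *: f + g) = Num.conj a *: op_adj f + op_adj g.
Proof.
apply: op_adj_unique => x y.
by rewrite !(op_addE, op_scaleE) hdot_linl hdotDr hdotZr conjCK !op_adjP.
Qed.
Lemma op_adj_comp (f g : bop) : op_adj (op_comp f g) = op_comp (op_adj g) (op_adj f).
Proof. by apply: op_adj_unique => x y /=; rewrite !op_adjP. Qed.

HB.instance Definition _ := isCStarAlgebra.Build C bop op_compA op_comp1x op_compx1
  op_comp_linl op_comp_linr op_adjK op_adj_antilinear op_adj_comp op_comp_norm op_cstar.
End BoundedOperators.

(** * States on C*-algebras *)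

Section CStarBasics.
Variables (C : numClosedFieldType) (A : cstarAlgType C).
Implicit Types x y z : A.

Lemma cmulDl x y z : cmul (x + y) z = cmul x z + cmul y z.
Proof. by rewrite -[x]scale1r cmul_linearl !scale1r. Qed.
Lemma cmulDr x y z : cmul z (x + y) = cmul z x + cmul z y.
Proof. by rewrite -[x]scale1r cmul_linearr !scale1r. Qed.
Lemma cmul0l z : cmul 0 z = 0.
Proof. by apply: (addrI (cmul 0 z)); rewrite -cmulDl !addr0. Qed.
Lemma cmul0r z : cmul z 0 = 0.
Proof. by apply: (addrI (cmul z 0)); rewrite -cmulDr !addr0. Qed.
Lemma cmulZl a x z : cmul (a *: x) z = a *: cmul x z.
Proof. by rewrite -[a *: x]addr0 cmul_linearl cmul0l addr0. Qed.
Lemma cmulZr a x z : cmul z (a *: x) = a *: cmul z x.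
Proof. by rewrite -[a *: x]addr0 cmul_linearr cmul0r addr0. Qed.
Lemma cmulBl x y z : cmul (x - y) z = cmul x z - cmul y z.
Proof. by rewrite -scaleN1r cmulDl cmulZl scaleN1r. Qed.
Lemma cmulBr x y z : cmul z (x - y) = cmul z x - cmul z y.
Proof. by rewrite -scaleN1r cmulDr cmulZr scaleN1r. Qed.

Lemma starD x y : star (x + y) = star x + star y.
Proof. by rewrite -[x]scale1r star_antilinear rmorph1 !scale1r. Qed.
Lemma star0 : star (0 : A) = 0.
Proof. by apply: (addrI (star 0)); rewrite -starD !addr0. Qed.
Lemma starZ (a : C) x : star (a *: x) = Num.conj a *: star x.
Proof. by rewrite -[a *: x]addr0 star_antilinear star0 addr0. Qed.
Lemma starB x y : star (x - y) = star x - star y.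
Proof. by rewrite -scaleN1r starD starZ rmorphN rmorph1 scaleN1r. Qed.
Lemma star1 : star (cone : A) = cone.
Proof. by rewrite -[star cone]cmul1x -[X in cmul X _]starK -star_mul cmul1x starK. Qed.

(** By the C*-identity the squared norm of y is at most the product of the norms of y* and y. *)
Lemma norm_star x : `|star x| = `|x|.
Proof.
have le y : `|y| <= `|star y|.
  have [->|y0] := eqVneq y 0; first by rewrite star0 normr0.
  have ny : 0 < `|y| by rewrite normr_gt0.
  by rewrite -(ler_pM2r ny) -expr2 -cnorm_star cnorm_mul.
by apply/eqP; rewrite eq_le; apply/andP; split; [rewrite -{2}(starK x)|]; exact: le.
Qed.
End CStarBasics.

Section SquareRoot.
Variables (C : numClosedFieldType) (lubC : lub_property C) (A : cstarAlgType C).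
Variables (x : A) (xsa : star x = x) (x1 : `|x| < 1).
Let r := `|x|.
Let r0 : 0 <= r. Proof. exact: normr_ge0. Qed.

Let step (u : A) : A := 2^-1 *: (x + cmul u u).
Let u k := iter k step 0.

Let half0 : 0 < 2^-1 :> C. Proof. by rewrite invr_gt0. Qed.

Let u_le k : `|u k| <= r.
Proof.
elim: k => [|k IH]; first by rewrite /u /= normr0.
rewrite /u iterS -/(u k) /step normrZ gtr0_norm// mulrC ler_pdivrMr//.
apply: le_trans (ler_normD _ _) _; rewrite mulrDr mulr1 lerD//.
apply: le_trans (cnorm_mul _ _) _; apply: le_trans (_ : 1 * r <= _); last by rewrite mul1r.
by apply: ler_pM => //; apply: le_trans IH _; exact: ltW.
Qed.

Let step_lip v w : `|step v - step w| <= 2^-1 * ((`|v| + `|w|) * `|v - w|).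
Proof.
rewrite /step -scalerBr normrZ gtr0_norm// ler_wpM2l ?(ltW half0)//.
have -> : x + cmul v v - (x + cmul w w) = cmul v (v - w) + cmul (v - w) w.
  by rewrite cmulBr cmulBl [in LHS]opprD addrACA subrr add0r addrA subrK.
apply: le_trans (ler_normD _ _) _; rewrite mulrDl lerD ?cnorm_mul//.
by apply: le_trans (cnorm_mul _ _) _; rewrite mulrC.
Qed.

Let u_step k : `|u k.+1 - u k| <= r ^+ k.
Proof.
elim: k => [|k IH].
  rewrite expr0 /u /= /step cmul0l addr0 subr0 normrZ gtr0_norm//.
  by rewrite mulrC ler_pdivrMr// mul1r (le_trans (ltW x1))// ler1n.
rewrite {1}/u iterS -/(u k.+1) {2}/u iterS -/(u k).
apply: le_trans (step_lip _ _) _; rewrite mulrA exprS.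
apply: ler_pM => //.
rewrite mulrC ler_pdivrMr// mulr_natr mulr2n.
by apply: lerD; exact: u_le.
Qed.

Let u_cauchy n m : (1 - r) * `|u (n + m) - u n| <= r ^+ n.
Proof.
have r1 : 0 < 1 - r by rewrite subr_gt0.
suff : (1 - r) * `|u (n + m) - u n| <= r ^+ n - r ^+ (n + m).
  by move=> /le_trans; apply; rewrite lerBlDr lerDl; exact: exprn_ge0.
elim: m => [|m IH]; first by rewrite addn0 !subrr normr0 mulr0.
apply: le_trans (_ : (1 - r) * (`|u (n + m.+1) - u (n + m)| + `|u (n + m) - u n|) <= _).
  by rewrite (ler_wpM2l (ltW r1))// ler_distD.
rewrite mulrDr; apply: le_trans (lerD (lexx _) IH) _.
rewrite addnS; apply: le_trans (lerD (ler_wpM2l (ltW r1) (u_step _)) (lexx _)) _.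
by rewrite le_eqVlt; apply/orP; left; apply/eqP; rewrite exprS; ring.
Qed.

Let u_small e : 0 < e -> exists N, forall n m, (N <= n)%N -> (N <= m)%N -> `|u n - u m| <= e.
Proof.
move=> e0; have r1 : 0 < 1 - r by rewrite subr_gt0.
have e1 : 0 < e / 2 * (1 - r) by rewrite mulr_gt0// divr_gt0.
have r01 : 0 <= r < 1 by rewrite normr_ge0.
have [N hN] := lub_geometric lubC r01 e1; exists N.
have hn n : (N <= n)%N -> `|u n - u N| <= e / 2.
  move=> Nn; rewrite -(subnKC Nn) -(ler_pM2l r1) mulrC.
  by rewrite mulrC (le_trans (u_cauchy _ _))// mulrC ltW.
move=> n m /hn hn1 /hn hm1; apply: le_trans (ler_distD (u N) _ _) _.
by rewrite [leRHS]splitr lerD// distrC.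
Qed.

Let u_lim : exists v, forall e, 0 < e -> exists n, `|u n - v| <= e /\ `|u n.+1 - v| <= e.
Proof.
have uc : cauchy (u @ \oo).
  apply/cauchyP => e e0; have [N hN] := u_small (divr_gt0 e0 (ltr0Sn C 1)).
  exists (u N); exists N => // n /= Nn; rewrite -ball_normE /=.
  apply: le_lt_trans (hN _ _ _ Nn) _ => //.
  by rewrite ltr_pdivrMr// ltr_pMr// ltr1n.
have hv : u @ \oo --> lim (u @ \oo) by exact: cauchy_cvg.
exists (lim (u @ \oo)) => e e0.
have [N _ hN] := (iffLR (cvgrPdist_le _ _) hv) e e0.
by exists N; split; rewrite distrC; apply: hN => /=.
Qed.

(** With y = 1 - u the equation 1 - x = y* y reads u = (x + u u) / 2 for a
self-adjoint u. On the ball of radius r = `|x| < 1 the right-hand side is a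
contraction with constant r; its iterates from 0 are self-adjoint and converge. *)
Lemma one_minus_square : exists y : A, cone - x = cmul (star y) y.
Proof.
have [v hv] := u_lim.
have ustar k : star (u k) = u k.
  elim: k => [|k IH]; first exact: star0.
  by rewrite /u iterS -/(u k) /step starZ starD star_mul IH xsa fmorphV rmorph_nat.
have vstar : star v = v.
  apply/eqP; rewrite -subr_eq0 -normr_le0; apply/ler_addgt0Pr => e e0.
  have [n [hn _]] := hv _ (divr_gt0 e0 (ltr0Sn C 1)).
  rewrite add0r (splitr e) -(subrKA (u n)) -{1}(ustar n) -starB.
  by apply: le_trans (ler_normD _ _) _; rewrite norm_star lerD// distrC.
have fix_v : v = step v.
  apply/eqP; rewrite -subr_eq0 -normr_le0; apply/ler_addgt0Pr => e e0.
  pose M := 1 + (r + `|v|).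
  have M0 : 0 < M by rewrite ltr_wpDr// addr_ge0// normr_ge0.
  have [n [hn hn1]] := hv _ (divr_gt0 e0 M0).
  rewrite add0r -(subrKA (u n.+1)); apply: le_trans (ler_normD _ _) _.
  apply: le_trans (_ : e / M + (r + `|v|) * (e / M) <= _).
    apply: lerD; first by rewrite distrC.
    rewrite {1}/u iterS -/(u n); apply: le_trans (step_lip _ _) _.
    rewrite -[leRHS]mul1r; apply: ler_pM.
    - exact: ltW half0.
    - by rewrite mulr_ge0// addr_ge0.
    - by rewrite invf_le1// ler1n.
    - by apply: ler_pM => //; rewrite lerD2r u_le.
  by rewrite -{1}[e / M]mul1r -mulrDl -/M mulrCA divff ?mulr1// gt_eqF.
exists (cone - v); rewrite starB star1 vstar cmulBl !cmulBr cmul1x cmulx1 cmul1x.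
have h2 : v + v = x + cmul v v.
  by rewrite -mulr2n -scaler_nat {1}fix_v /step scalerA divff ?scale1r// pnatr_eq0.
have -> : x = v + v - cmul v v by rewrite h2 addrK.
by rewrite !opprB addrACA -opprD addrA.
Qed.
End SquareRoot.

Section States.
Variables (C : numClosedFieldType) (lubC : lub_property C) (A : cstarAlgType C).
Variables (w : A -> C) (ws : is_state w).

Let wl : scalar w. Proof. by case: ws. Qed.

Lemma stateD x y : w (x + y) = w x + w y.
Proof. by rewrite -[x]scale1r wl mul1r scale1r. Qed.
Lemma state0 : w 0 = 0.
Proof. by apply: (addrI (w 0)); rewrite -stateD !addr0. Qed.
Lemma stateZ a x : w (a *: x) = a * w x.
Proof. by rewrite -[a *: x]addr0 wl state0 addr0. Qed.
Lemma stateB x y : w (x - y) = w x - w y.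
Proof. by rewrite -scaleN1r stateD stateZ mulN1r. Qed.
Lemma state1 : w cone = 1. Proof. by case: ws. Qed.
Lemma state_ge0 x : 0 <= w (cmul (star x) x). Proof. by case: ws. Qed.

Definition state_form (a b : A) : C := w (cmul (star b) a).

Lemma state_form_linl (k : C) a b c :
  state_form (k *: a + b) c = k * state_form a c + state_form b c.
Proof. by rewrite /state_form cmulDr cmulZr stateD stateZ. Qed.

Lemma state_form_ge0 a : 0 <= state_form a a. Proof. exact: state_ge0. Qed.

(** f (a + b) (a + b) is real, so f a b + f b a is real; the same for a and i b
shows that f a b - f b a is purely imaginary; hence f b a is the conjugate of f a b. *)
Lemma state_form_conj a b : state_form b a = Num.conj (state_form a b).
Proof.
have rl c d : state_form c d + state_form d c =
   Num.conj (state_form c d) + Num.conj (state_form d c).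
  have e : state_form (c + d) (c + d) =
     (state_form c d + state_form d c) + (state_form c c + state_form d d).
    rewrite /state_form starD !cmulDl !cmulDr !stateD; ring.
  have s e' : Num.conj (state_form e' e') = state_form e' e'.
    by apply/CrealP; exact: ger0_real (state_form_ge0 e').
  by have := s (c + d); rewrite e !rmorphD /= !s => /addIr ->.
have [I [I2 Ic]] := ex_imaginary C.
have h1 := rl a b; have := rl a (I *: b).
have -> : state_form a (I *: b) = - I * state_form a b.
  by rewrite /state_form starZ cmulZl stateZ Ic.
have -> : state_form (I *: b) a = I * state_form b a.
  by rewrite /state_form cmulZr stateZ.
rewrite !rmorphM /= rmorphN /= Ic opprK => h2.
have I0 : I != 0.
  by apply/eqP => I0; move: I2; rewrite I0 mul0r => /esym/eqP; rewrite oppr_eq0 oner_eq0.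
move: h1 h2; set P := state_form a b; set Q := state_form b a => h1 h2.
have h3 : - P + Q = Num.conj P - Num.conj Q.
  by apply: (mulfI I0); rewrite mulrDr mulrN -mulNr h2; ring.
have h4 : Q + Q = Num.conj P + Num.conj P.
  rewrite (_ : Q + Q = (P + Q) + (- P + Q)); last by ring.
  by rewrite h1 h3; ring.
apply: (@mulfI _ 2); first by rewrite pnatr_eq0.
by rewrite !mulr_natl !mulr2n.
Qed.

Lemma state_star x : w (star x) = Num.conj (w x).
Proof.
have := state_form_conj x cone; rewrite /state_form star1 cmul1x => <-.
by rewrite cmulx1.
Qed.

Lemma state_CS a b : `|w (cmul (star b) a)| ^+ 2 <= w (cmul (star a) a) * w (cmul (star b) b).
Proof. exact: (pform_CS state_form_linl state_form_conj state_form_ge0). Qed.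

(** For t > `|a| ^+ 2 the element 1 - a* a / t is a square, so the state is
nonnegative on it. *)
Lemma state_sq_le a : w (cmul (star a) a) <= `|a| ^+ 2.
Proof.
apply/ler_addgt0Pr => e e0.
have t0 : 0 < `|a| ^+ 2 + e by rewrite ltr_wpDl// exprn_ge0.
set t := _ + e in t0 *.
pose x := t^-1 *: cmul (star a) a.
have xsa : star x = x.
  rewrite /x starZ star_mul starK; congr (_ *: _).
  by apply/CrealP; rewrite ger0_real// invr_ge0 ltW.
have x1 : `|x| < 1.
  rewrite /x normrZ gtr0_norm ?invr_gt0// cnorm_star mulrC ltr_pdivrMr// mul1r.
  by rewrite /t ltrDl.
have [y hy] := one_minus_square lubC xsa x1.
have := state_ge0 y; rewrite -hy stateB state1 /x stateZ subr_ge0.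
by rewrite mulrC ler_pdivrMr// mul1r.
Qed.

Lemma state_bounded a : `|w a| <= `|a|.
Proof.
rewrite -(@ler_pXn2r _ 2) ?nnegrE//; apply: le_trans (state_sq_le a).
by have := state_CS a cone; rewrite star1 !cmul1x state1 mulr1.
Qed.

(** Cauchy-Schwarz for the form of the state. *)
Lemma state_null_r b x : w (cmul (star b) b) = 0 -> w (cmul x b) = 0.
Proof.
move=> b0; apply/eqP; rewrite -normr_eq0 -sqrf_eq0 eq_le exprn_ge0// andbT.
by have := state_CS b (star x); rewrite starK b0 mul0r.
Qed.

Lemma state_null_l b x : w (cmul (star b) b) = 0 -> w (cmul (star b) x) = 0.
Proof.
move=> b0; have := state_star (cmul (star x) b); rewrite star_mul starK => ->.
by rewrite state_null_r// rmorph0.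
Qed.
End States.

(** * Words in the Cuntz generators *)

Lemma closed_normP (C : numFieldType) (V : normedModType C) (S : set V) :
  closed S <-> forall x, (forall e : C, 0 < e -> exists y, S y /\ `|x - y| <= e) -> S x.
Proof.
split=> [cS x h|h].
  apply: cS => B /nbhs_ballP[e /= e0 eB].
  have [y [Sy xy]] := h _ (divr_gt0 e0 (ltr0Sn C 1)).
  exists y; split=> //; apply: eB; rewrite -ball_normE /=.
  by apply: le_lt_trans xy _; rewrite ltr_pdivrMr// ltr_pMr// ltr1n.
move=> x clx; apply: h => e e0.
have [y [Sy By]] := clx (ball x e) (nbhsx_ballx x e e0).
by exists y; split=> //; move: By; rewrite -ball_normE /= => /ltW.
Qed.

Definition tail (T : Type) (x : nat -> T) k : nat -> T := fun i => x (k + i)%N.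

Lemma tail_tail (T : Type) (x : nat -> T) a b : tail (tail x a) b = tail x (a + b).
Proof. by apply/funext => i; rewrite /tail addnA. Qed.

Lemma mkseq_add (T : Type) (x : nat -> T) a b :
  mkseq x (a + b) = mkseq x a ++ mkseq (tail x a) b.
Proof.
rewrite /mkseq /tail iotaD map_cat add0n; congr (_ ++ _).
by rewrite -[X in iota X]addn0 iotaDl -map_comp.
Qed.

Section Words.
Variables (C : numClosedFieldType) (lubC : lub_property C) (n : enat).
Variables (A : cstarAlgType C) (s : idx n -> A) (cs : cuntz_relations s).
Local Notation W := (seq (idx n)).
Local Notation S := (word_prod s).
Local Notation "x ** y" := (cmul x y) (at level 40, left associativity).

Lemma cuntz_isometry i j : star (s i) ** s j = (i == j)%:R *: cone.
Proof.
by move: cs; rewrite /cuntz_relations; clear cs; case: n s i j => [m|] s' i j [h _]; exact: h.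
Qed.

Lemma word_prod_cat (I J : W) : S (I ++ J) = S I ** S J.
Proof. by elim: I => [|i I IH] /=; rewrite ?cmul1x// IH cmulA. Qed.

Lemma word_isometry_cat (I J : W) : star (S I) ** S (I ++ J) = S J.
Proof.
elim: I => [|i I IH] /=; first by rewrite star1 cmul1x.
rewrite star_mul -cmulA (cmulA (star (s i))) cuntz_isometry eqxx scale1r cmul1x.
exact: IH.
Qed.

Lemma word_isometry (I : W) : star (S I) ** S I = cone.
Proof. by rewrite -{2}[I]cats0 word_isometry_cat. Qed.

Lemma word_orthogonal (I J : W) : size I = size J -> I != J -> star (S I) ** S J = 0.
Proof.
elim: I J => [|i I IH] [|j J] //= [sIJ] IJ.
rewrite star_mul -cmulA (cmulA (star (s i))) cuntz_isometry.
have [ij|ij] := eqVneq i j; last by rewrite scale0r cmul0l cmul0r.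
by rewrite scale1r cmul1x IH//; apply: contra_neq IJ => ->; rewrite ij.
Qed.

(** Cancel the common part of the two words from the middle; if a letter differs,
the ranges are orthogonal. *)
Lemma word_cases (K L : W) : [\/ exists M, L = K ++ M, exists M, K = L ++ M |
  star (S K) ** S L = 0].
Proof.
have key (I J : W) : (size I <= size J)%N -> (exists M, J = I ++ M) \/
    star (S I) ** S J = 0.
  move=> IJ; have [e|ne] := eqVneq I (take (size I) J).
    by left; exists (drop (size I) J); rewrite {1}e cat_take_drop.
  right; rewrite -(cat_take_drop (size I) J) word_prod_cat cmulA.
  by rewrite word_orthogonal ?cmul0l// size_takel.
have [/key[h|h]|/ltnW/key[h|h]] := leqP (size K) (size L).
- by constructor 1.
- by constructor 3.
- by constructor 2.
- by constructor 3; rewrite -[X in _ ** X]starK -star_mul h star0.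
Qed.

Hypothesis gen : smallest (@closed_unital_star_subalg C A) (range s) = setT.

(** The products of s_I with the adjoint of s_K are closed under adjoints and, by
[word_cases], products are again such products or 0. So the least closed subspace
W0 that contains them is a C*-algebra containing the generators. *)
Lemma cuntz_span (V : set A) : closed V -> V 0 ->
  (forall (a : C) x y, V x -> V y -> V (a *: x + y)) ->
  (forall I K, V (S I ** star (S K))) -> forall x, V x.
Proof.
move=> cV V0 Vl Vg x; pose good (B : set A) := [/\ closed B, B 0,
  (forall (a : C) x y, B x -> B y -> B (a *: x + y)) &
  (forall I K, B (S I ** star (S K)))].
suff : forall B, good B -> B x by apply.
pose W0 : set A := fun y => forall B, good B -> B y; rewrite -/(W0 x).
have W0g : good W0.
  split.
  - move=> y cly B gB; have [cB _ _ _] := gB; apply: cB.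
    by apply: closure_subset cly => y' h; exact: h.
  - by move=> B [].
  - by move=> a y t hy ht B gB; have [_ _ h _] := gB; apply: h; [exact: hy|exact: ht].
  - by move=> I K B [].
(* Preimages of W0 under Lipschitz real-linear maps are again closed subspaces. *)
have pull (f : A -> A) (theta : C -> C) (M : C) : 0 <= M ->
    (forall a y t, f (a *: y + t) = theta a *: f y + f t) -> f 0 = 0 ->
    (forall y t, `|f y - f t| <= M * `|y - t|) ->
    (forall I K, W0 (f (S I ** star (S K)))) -> forall y, W0 y -> W0 (f y).
  move=> M0 fl f0 fM fg y hy; apply: (hy (fun y => W0 (f y))).
  have [cW W00 Wl _] := W0g; split=> //; last 2 first.
  - by rewrite f0.
  - by move=> a u v hu hv; rewrite fl; apply: Wl.
  apply/closed_normP => u hu; move/closed_normP: cW; apply => e e0.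
  have M1 : 0 < M + 1 by rewrite ltr_wpDl.
  have [v [Wv uv]] := hu _ (divr_gt0 e0 M1); exists (f v); split=> //.
  apply: le_trans (fM _ _) _; apply: le_trans (_ : M * (e / (M + 1)) <= _).
    by rewrite ler_wpM2l.
  by rewrite mulrCA (ler_piMr (ltW e0))// ler_pdivrMr// mul1r lerDl.
have [cW W00 Wl Wg] := W0g.
have mulg I K I' K' : W0 (S I ** star (S K) ** (S I' ** star (S K'))).
  rewrite cmulA -(cmulA (S I)).
  have [[M ->]|[M ->]|->] := word_cases K I'.
  - by rewrite word_isometry_cat -word_prod_cat.
  - have -> : star (S (I' ++ M)) ** S I' = star (S M).
      by rewrite -[X in _ ** X]starK -star_mul word_isometry_cat.
    by rewrite -cmulA -star_mul -word_prod_cat.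
  - by rewrite cmul0r cmul0l.
have mulW y t : W0 y -> W0 t -> W0 (y ** t).
  (* First for products with the spanning elements, then for all of W0. *)
  have mg I K t' : W0 t' -> W0 (t' ** (S I ** star (S K))).
    apply: (pull (fun t' => t' ** _) id `|S I ** star (S K)|) => //.
    - by move=> a u v; rewrite cmul_linearl.
    - exact: cmul0l.
    - by move=> u v; rewrite -cmulBl mulrC cnorm_mul.
  move=> hy; apply: (pull (cmul y) id `|y|) => //.
  - by move=> a u v; rewrite cmul_linearr.
  - exact: cmul0r.
  - by move=> u v; rewrite -cmulBr cnorm_mul.
  - by move=> I K; apply: mg.
have starW y : W0 y -> W0 (star y).
  apply: (pull star Num.conj 1) => //.
  - by move=> a u v; rewrite star_antilinear.
  - exact: star0.
  - by move=> u v; rewrite -starB norm_star mul1r.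
  - by move=> I K; rewrite star_mul starK.
have : smallest (@closed_unital_star_subalg C A) (range s) `<=` W0.
  apply: smallest_sub; first split=> //.
    by have := Wg [::] [::]; rewrite /= star1 cmul1x.
  move=> _ [i _ <-]; have := Wg [:: i] [::].
  by rewrite /= star1 !cmulx1.
by rewrite gen => /(_ x Logic.I).
Qed.

Definition proj_word (x : nat -> idx n) m := S (mkseq x m) ** star (S (mkseq x m)).

Lemma proj_word_idem x m : proj_word x m ** proj_word x m = proj_word x m.
Proof.
rewrite /proj_word cmulA -[X in X ** _]cmulA word_isometry.
by rewrite cmulx1.
Qed.

Lemma proj_word_star x m : star (proj_word x m) = proj_word x m.
Proof. by rewrite /proj_word star_mul starK. Qed.

(** Let the first a letters of the longer prefix cancel. *)
Lemma proj_word_absorb x a N : proj_word x (a + N) ** S (mkseq x a) =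
  S (mkseq x a) ** proj_word (tail x a) N.
Proof.
rewrite /proj_word mkseq_add word_prod_cat star_mul -!cmulA word_isometry.
by rewrite cmulx1.
Qed.

Lemma proj_word_absorb_star x a N : star (S (mkseq x a)) ** proj_word x (a + N) =
  proj_word (tail x a) N ** star (S (mkseq x a)).
Proof.
by rewrite -[LHS]starK star_mul starK proj_word_star proj_word_absorb star_mul proj_word_star.
Qed.

Lemma mkseq_neq (x y : nat -> idx n) : x <> y -> exists N, mkseq x N != mkseq y N.
Proof.
move=> xy; apply: contrapT => h; apply: xy; apply/funext => i.
have /eqP : mkseq x i.+1 == mkseq y i.+1.
  by apply: contrapT => /negP h'; apply: h; exists i.+1.
move=> /(congr1 (fun t => nth (x i) t i)).
by rewrite !nth_mkseq.
Qed.

Lemma proj_word_ortho (x y : nat -> idx n) : x <> y -> exists N, proj_word x N ** proj_word y N = 0.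
Proof.
move=> /mkseq_neq[N hN]; exists N; rewrite /proj_word cmulA -[X in X ** _]cmulA.
by rewrite word_orthogonal ?size_mkseq// cmul0r cmul0l.
Qed.

(** Enclose the product between long range projections of prefixes of x and y:
these annihilate a word that is not a prefix, and after cancelling the prefixes
I and K there remain range projections of prefixes of the two tails in the
middle, which are orthogonal once the tails have been seen to differ. *)
Lemma functional_support (phi : A -> C) (x y : nat -> idx n) : phi 0 = 0 ->
  (forall m a, phi (proj_word x m ** a) = phi a) ->
  (forall m a, phi (a ** proj_word y m) = phi a) ->
  forall I K, phi (S I ** star (S K)) != 0 ->
  exists a b, [/\ I = mkseq x a, K = mkseq y b &
    tail x a = tail y b].
Proof.
move=> phi0 hx hy I K nz.
have left (z : nat -> idx n) (L : W) :
    L != mkseq z (size L) -> proj_word z (size L) ** S L = 0.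
  by move=> LL; rewrite /proj_word -cmulA word_orthogonal ?cmul0r ?size_mkseq// eq_sym.
have right (z : nat -> idx n) (L : W) :
    L != mkseq z (size L) -> star (S L) ** proj_word z (size L) = 0.
  by move=> /left/(congr1 star); rewrite star_mul proj_word_star star0.
have IE : I = mkseq x (size I).
  apply/eqP; apply: contraNT nz => /left h.
  by rewrite -(hx (size I)) cmulA h cmul0l phi0.
have KE : K = mkseq y (size K).
  apply/eqP; apply: contraNT nz => /right h.
  by rewrite -(hy (size K)) -cmulA h cmul0r phi0.
exists (size I), (size K); split=> //; apply: contrapT => /proj_word_ortho[N hN].
move/eqP: nz; apply; rewrite -(hx (size I + N)%N) -(hy (size K + N)%N).
rewrite cmulA {2}IE proj_word_absorb -IE -cmulA.
rewrite {1}KE proj_word_absorb_star -KE.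
by rewrite -(cmulA (S I)) (cmulA (proj_word _ N)) hN cmul0l cmul0r.
Qed.

End Words.

(** * States that follow a word *)

Section Covariance.
Variables (C : numClosedFieldType) (lubC : lub_property C) (n : enat).
Variables (A : cstarAlgType C) (s : idx n -> A) (cs : cuntz_relations s).
Hypothesis gen : smallest (@closed_unital_star_subalg C A) (range s) = setT.
Local Notation S := (word_prod s).
Local Notation "x ** y" := (cmul x y) (at level 40, left associativity).
Implicit Types (x : nat -> idx n) (w u v phi : A -> C) (d : enat).

Definition follows w x := forall m, w (proj_word s x m) = 1.

Definition has_phase w x d (z : C) :=
  if d is Fin d0 then w (S (mkseq x d0)) = z else True.

(** The number of distinct tails of x is d, and if d is finite x is purely periodic. *)
Definition tail_period x d := match d with
  | Fin d0 => (0 < d0)%N /\ forall a b, tail x a = tail x b <-> a = b %[mod d0]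
  | Inf => forall a b, tail x a = tail x b -> a = b
  end.

(** Satisfied by phi(a) = <a v, u> if w is the vector state of u: an element
b with w(b* b) = 0 kills u. *)
Definition left_null w phi := forall b a, w (star b ** b) = 0 -> phi (star b ** a) = 0.
Definition right_null w phi := forall b a, w (star b ** b) = 0 -> phi (a ** b) = 0.

Definition tail_covariant x d (z : C) phi :=
  [/\ phi 0 = 0, forall m a, phi (proj_word s x m ** a) = phi a,
      forall m a, phi (a ** proj_word s x m) = phi a &
      if d is Fin d0 then forall a, phi (S (mkseq x d0) ** a) = z * phi a /\
         phi (star (S (mkseq x d0)) ** a) = Num.conj z * phi a
      else True].

(** The defect of a projection is its own square, and w vanishes on it. *)
Lemma state_proj_defect w x m (ws : is_state w) : follows w x ->
  w (star (cone - proj_word s x m) ** (cone - proj_word s x m)) = 0.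
Proof.
move=> wx; rewrite starB star1 proj_word_star cmulBl !cmulBr cmul1x cmulx1 cmul1x.
by rewrite proj_word_idem// subrr subr0 (stateB ws) (state1 ws) wx subrr.
Qed.

Section Linear.
Variables (phi : A -> C) (phil : scalar phi).

Let phi0 : phi 0 = 0.
Proof. by have := phil (-1) 0 0; rewrite scaler0 addr0 mulN1r addNr. Qed.
Let phiB a b : phi (a - b) = phi a - phi b.
Proof. by rewrite addrC -scaleN1r phil mulN1r addrC. Qed.
Let phiZ k a : phi (k *: a) = k * phi a.
Proof. by rewrite -[k *: a]addr0 phil phi0 addr0. Qed.

Lemma left_null_proj w x m a : is_state w -> left_null w phi -> follows w x ->
  phi (proj_word s x m ** a) = phi a.
Proof.
move=> ws ln wx; have := ln _ a (state_proj_defect m ws wx).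
rewrite starB star1 proj_word_star cmulBl cmul1x phiB => /eqP.
by rewrite subr_eq0 => /eqP.
Qed.

Lemma right_null_proj w x m a : is_state w -> right_null w phi -> follows w x ->
  phi (a ** proj_word s x m) = phi a.
Proof.
move=> ws rn wx; have := rn _ a (state_proj_defect m ws wx).
by rewrite cmulBr cmulx1 phiB => /eqP; rewrite subr_eq0 => /eqP.
Qed.

(** If an isometry has an expectation z of modulus 1 then the vector of the state
is an eigenvector, since the squared norm of its image minus z times it is
1 - 1 - 1 + 1. *)
Lemma state_eigen_defect w J (z : C) : is_state w -> `|z| = 1 -> w (S J) = z ->
  w (star (S J - z *: cone) ** (S J - z *: cone)) = 0.
Proof.
move=> ws z1 wz; rewrite starB starZ star1 cmulBl !cmulBr word_isometry//.
rewrite !cmulZl !cmulZr !cmulx1 !cmul1x !(stateB ws) !(stateZ ws) (state_star ws) wz (state1 ws).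
have zz : z * Num.conj z = 1 by rewrite -normCK z1 expr1n.
by rewrite mulr1 (mulrC (Num.conj z) z) zz !subrr.
Qed.

Lemma right_null_eigen w J (z : C) a : is_state w -> right_null w phi -> `|z| = 1 ->
  w (S J) = z -> phi (a ** S J) = z * phi a.
Proof.
move=> ws rn z1 wz; have := rn _ a (state_eigen_defect ws z1 wz).
by rewrite cmulBr cmulZr cmulx1 phiB phiZ => /eqP; rewrite subr_eq0 => /eqP.
Qed.

Lemma left_null_eigen w J (z : C) a : is_state w -> left_null w phi -> `|z| = 1 ->
  w (S J) = z -> phi (star (S J) ** a) = Num.conj z * phi a.
Proof.
move=> ws ln z1 wz; have := ln _ a (state_eigen_defect ws z1 wz).
rewrite starB starZ star1 cmulBl cmulZl cmul1x phiB phiZ => /eqP.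
by rewrite subr_eq0 => /eqP.
Qed.

(** By [state_eigen_defect] the adjoint of the word of the period acts on the left
as the conjugate of z; the word itself then acts as z, since it is an isometry. *)
Lemma left_null_covariant w w' x d z : is_state w -> is_state w' -> `|z| = 1 ->
  left_null w phi -> right_null w' phi -> follows w x -> follows w' x ->
  has_phase w x d z -> tail_covariant x d z phi.
Proof.
move=> ws ws' z1 ln rn wx wx' ph; split=> //.
- by move=> m a; exact: left_null_proj ws ln wx.
- by move=> m a; exact: right_null_proj ws' rn wx'.
case: d ph => //= d0 wz a; split; last exact: left_null_eigen ws ln z1 wz.
have e := left_null_eigen (S (mkseq x d0) ** a) ws ln z1 wz.
rewrite cmulA word_isometry// cmul1x in e.
by rewrite e mulrA -normCK z1 expr1n mul1r.
Qed.
End Linear.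

(** If the tails left over by I and K agree, the longer of the two words is the
shorter one preceded by q periods. The periods contribute the q-th power of z or
of its conjugate, and the shorter word contributes a range projection. *)
Lemma covariant_values x d z : tail_period x d ->
  forall I K, exists c, forall phi, tail_covariant x d z phi ->
  phi (S I ** star (S K)) = c * phi cone.
Proof.
move=> per I K.
have [[a [b [IE KE ab]]]|no] := pselect (exists a b,
  [/\ I = mkseq x a, K = mkseq x b & tail x a = tail x b]); last first.
  exists 0 => phi [phi0 hl hr _]; rewrite mul0r; apply/eqP; apply: contrapT => /negP nz.
  by apply: no; apply: (functional_support cs phi0 hl hr nz).
case: d per => [d0|] /= per; last first.
  exists 1 => phi [_ hl _ _]; rewrite mul1r IE KE (per _ _ ab) -/(proj_word s x b).
  by rewrite -[proj_word s x b]cmulx1 hl.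
have [d00 perP] := per.
have tq q : tail x (q * d0) = x.
  have /perP -> : (q * d0)%N = 0 %[mod d0] by rewrite modnMl mod0n.
  by apply/funext.
have split q b' : S (mkseq x (q * d0 + b')) = S (mkseq x (q * d0)) ** S (mkseq x b').
  by rewrite mkseq_add word_prod_cat tq.
have act phi q a' : tail_covariant x (Fin d0) z phi ->
    phi (S (mkseq x (q * d0)) ** a') = z ^+ q * phi a' /\
    phi (star (S (mkseq x (q * d0))) ** a') = Num.conj z ^+ q * phi a'.
  move=> [_ _ _ h]; elim: q a' => [|q IH] a'.
    by rewrite mul0n !expr0 !mul1r /= star1 cmul1x.
  have e : S (mkseq x (q.+1 * d0)) = S (mkseq x d0) ** S (mkseq x (q * d0)).
    by rewrite mulSn mkseq_add word_prod_cat -[d0 in tail x d0]mul1n tq.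
  have e' : S (mkseq x (q.+1 * d0)) = S (mkseq x (q * d0)) ** S (mkseq x d0).
    by rewrite mulSn addnC split.
  split; first by rewrite e -cmulA (h _).1 (IH _).1 exprS mulrA.
  by rewrite e' star_mul -cmulA (h _).2 (IH _).2 exprS mulrA.
have /perP/eqP := ab.
have [le_ba|le_ab] := leqP b a.
  rewrite eqn_mod_dvd// => /dvdnP[q hq].
  exists (z ^+ q) => phi cov; have [_ hl hr _] := cov.
  have {}IE : I = mkseq x (q * d0 + b) by rewrite IE -hq subnK.
  rewrite IE split KE -cmulA -/(proj_word s x b) hr.
  by rewrite -[S _]cmulx1 (act _ _ _ cov).1.
rewrite eq_sym eqn_mod_dvd ?(ltnW le_ab)// => /dvdnP[q hq].
exists (Num.conj z ^+ q) => phi cov; have [_ hl hr _] := cov.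
have {}KE : K = mkseq x (q * d0 + a) by rewrite KE -hq subnK// ltnW.
rewrite KE split IE star_mul cmulA -/(proj_word s x a) hl.
by rewrite -[star _]cmulx1 (act _ _ _ cov).2.
Qed.

Lemma state_closed_eq u v : is_state u -> is_state v -> 
  (forall I K, u (S I ** star (S K)) = v (S I ** star (S K))) -> u = v.
Proof.
move=> us vs uv; apply/funext => y.
apply: (cuntz_span cs gen (V := [set y | u y = v y])) => //.
- apply/closed_normP => a h; apply/eqP; rewrite -subr_eq0 -normr_le0.
  apply/ler_addgt0Pr => e e0; rewrite add0r.
  have [b [/= ub hb]] := h _ (divr_gt0 e0 (ltr0Sn C 1)).
  have -> : u a - v a = u (a - b) - v (a - b).
    by rewrite (stateB us) (stateB vs) ub; ring.
  apply: le_trans (ler_normB _ _) _; rewrite [leRHS]splitr.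
  apply: lerD; apply: le_trans hb; [exact: (state_bounded lubC us)|exact: (state_bounded lubC vs)].
- by rewrite /= (state0 us) (state0 vs).
- by move=> k a b /= ha hb; rewrite (stateD us) (stateZ us) (stateD vs) (stateZ vs) ha hb.
Qed.

Lemma state_left_null u : is_state u -> left_null u u.
Proof. by move=> us b a; exact: state_null_l. Qed.

Lemma state_right_null u : is_state u -> right_null u u.
Proof. by move=> us b a; exact: state_null_r. Qed.

Lemma state_scalar u : is_state u -> scalar u. Proof. by case. Qed.

Lemma follows_unique x d z u v : tail_period x d -> `|z| = 1 -> is_state u -> is_state v ->
  follows u x -> follows v x -> has_phase u x d z -> has_phase v x d z -> u = v.
Proof.
move=> per z1 us vs ux vx uz vz; apply: state_closed_eq => // I K.
have [c hc] := covariant_values z per I K.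
have cov u' : is_state u' -> follows u' x -> has_phase u' x d z -> tail_covariant x d z u'.
  move=> us' ux' uz'; apply: (left_null_covariant _ us' us' z1 _ _ ux' ux' uz').
  - exact: state_scalar.
  - exact: state_left_null.
  - exact: state_right_null.
by rewrite !hc ?(state1 us) ?(state1 vs)//; apply: cov.
Qed.

(** 1 is an extreme point of the unit disc; compare real parts. *)
Lemma convex_unit (t a b : C) : 0 < t < 1 -> `|a| <= 1 -> `|b| <= 1 ->
  t * a + (1 - t) * b = 1 -> a = 1.
Proof.
move=> /andP[t0 t1] a1 b1 e.
have t1' : 0 < 1 - t by rewrite subr_gt0.
have ra : 'Re a <= 1.
  by apply: le_trans (real_ler_norm (Creal_Re _)) _; apply: le_trans (norm_Re_le _) a1.
have rb : 'Re b <= 1.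
  by apply: le_trans (real_ler_norm (Creal_Re _)) _; apply: le_trans (norm_Re_le _) b1.
have e1 : t * 'Re a + (1 - t) * 'Re b = 1.
  have := congr1 (fun c => 'Re c) e; rewrite raddfD /= !ReMl ?gtr0_real//.
  by rewrite (Creal_ReP 1 (real1 C)).
have ea : 'Re a = 1.
  apply/eqP; rewrite eq_le ra /= -(ler_pM2l t0) mulr1.
  rewrite -(lerD2r ((1 - t) * 'Re b)) e1.
  apply: le_trans (_ : t + (1 - t) * 1 <= _); first by rewrite lerD2l (ler_wpM2l (ltW t1')).
  by rewrite mulr1 addrC subrK.
have := a1; rewrite -(@ler_pXn2r _ 2) ?nnegrE// expr1n.
rewrite [X in `|X|]Crect normC2_rect ?Creal_Re ?Creal_Im// ea expr1n gerDl.
move=> h; have : 'Im a ^+ 2 == 0.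
  by rewrite eq_le h /= real_exprn_even_ge0// Creal_Im.
by rewrite sqrf_eq0 => /eqP ia; rewrite [a]Crect ia ea mulr0 addr0.
Qed.

Lemma state_le1 u J (us : is_state u) : `|u (S J)| <= 1.
Proof.
rewrite -(@ler_pXn2r _ 2) ?nnegrE// expr1n.
have := state_CS us (S J) cone; rewrite star1 !cmul1x word_isometry// (state1 us).
by rewrite mulr1.
Qed.

Lemma state_proj_le1 u x m (us : is_state u) : `|u (proj_word s x m)| <= 1.
Proof.
have p0 : 0 <= u (proj_word s x m).
  by have := state_ge0 us (proj_word s x m); rewrite proj_word_star proj_word_idem.
rewrite ger0_norm//; have := state_ge0 us (cone - proj_word s x m).
rewrite starB star1 proj_word_star cmulBl !cmulBr cmul1x cmulx1 cmul1x.
by rewrite proj_word_idem// subrr subr0 (stateB us) (state1 us) subr_ge0.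
Qed.

(** The states of a convex decomposition take values in the unit disc on the
projections and on the word of the period, where w takes values of modulus 1;
these are extreme, so the components agree with w there. *)
Lemma follows_pure x d z w : tail_period x d -> `|z| = 1 -> is_state w ->
  follows w x -> has_phase w x d z -> is_pure w.
Proof.
move=> per z1 ws wx wz; split=> // t u v t01 us vs wE.
have half t' u' v' : 0 < t' < 1 -> is_state u' -> is_state v' ->
    (forall a, w a = t' * u' a + (1 - t') * v' a) -> u' = w.
  move=> t01' us' vs' wE'.
  apply: (follows_unique per z1 us' ws _ wx _ wz).
    move=> m; apply: (convex_unit t01' (state_proj_le1 _ _ us') (state_proj_le1 x m vs')).
    by rewrite -wE' wx.
  case: d {per} wz => //= d0 wz.
  have zz : Num.conj z * z = 1 by rewrite mulrC -normCK z1 expr1n.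
  have : Num.conj z * u' (S (mkseq x d0)) = 1.
    apply: (convex_unit t01' (b := Num.conj z * v' (S (mkseq x d0)))).
    - by rewrite normrM norm_conjC z1 mul1r state_le1.
    - by rewrite normrM norm_conjC z1 mul1r state_le1.
    - transitivity (Num.conj z * w (S (mkseq x d0))); first by rewrite wE'; ring.
      by rewrite wz.
  by move=> /(congr1 ( *%R z)); rewrite mulrA (mulrC z) zz mul1r mulr1.
split; first exact: half wE.
have t01' : 0 < 1 - t < 1.
  by case/andP: t01 => t0 t1; rewrite subr_gt0 t1 /= gtrBl.
by apply: (half _ _ _ t01' vs us) => a; rewrite wE; ring.
Qed.
End Covariance.

(** * Almost orthogonal vectors in a closed span *)

Section Dimension.
Variables (C : numClosedFieldType) (H : hilbertType C).

Lemma closed_span_sub (X V : set H) : closed V -> lin_subspace V -> X `<=` V ->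
  closed_span X `<=` V.
Proof. by move=> cV lV XV; apply: smallest_sub. Qed.

Lemma closed_span_closed (X : set H) : closed (closed_span X).
Proof.
move=> y cly V [[cV lV] XV]; apply: (cV); apply: closure_subset cly => z; apply.
by split.
Qed.

Lemma closed_span_lin (X : set H) : lin_subspace (closed_span X).
Proof.
split; first by move=> V [[_ [V0 _]] _].
move=> a y z hy hz V VP; have [[_ [_ Vl]] _] := VP.
by apply: Vl; [exact: hy|exact: hz].
Qed.

Lemma sub_closed_span (X : set H) : X `<=` closed_span X.
Proof. exact: sub_smallest. Qed.

(** The vectors that equal their expansion form a subspace, which is closed since
the expansion is Lipschitz. *)
Lemma hdim_expand (k : nat) (e : 'I_k -> H) : (forall i j, hdot (e i) (e j) = (i == j)%:R) ->
  forall y, closed_span (range e) y -> y = \sum_i hdot y (e i) *: e i.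
Proof.
move=> orth; have ne i : `|e i| = 1.
  by apply/eqP; rewrite -(@eqrXn2 _ 2)// expr1n hdot_norm orth eqxx.
apply: closed_span_sub.
- apply/closed_normP => y h; apply/eqP; rewrite -subr_eq0 -normr_le0.
  apply/ler_addgt0Pr => d d0; rewrite add0r.
  have k1 : 0 < (1 + k%:R : C) by rewrite ltr_pwDl.
  have [z [zE yz]] := h _ (divr_gt0 d0 k1).
  have -> : y - \sum_i hdot y (e i) *: e i = (y - z) - \sum_i hdot (y - z) (e i) *: e i.
    have -> : \sum_i hdot (y - z) (e i) *: e i = \sum_i hdot y (e i) *: e i - z.
      rewrite [in RHS]zE -sumrB; apply: eq_bigr => i _.
      by rewrite hdotBl scalerBl.
    by rewrite opprB addrA subrK.
  apply: le_trans (ler_normB _ _) _.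
  apply: le_trans (_ : (d / (1 + k%:R)) * (1 + k%:R) <= _); last by rewrite divfK// gt_eqF.
  rewrite mulrDr mulr1; apply: lerD => //.
  apply: le_trans (ler_norm_sum _ _ _) _.
  apply: le_trans (_ : \sum_(i < k) (d / (1 + k%:R)) <= _); last first.
    by rewrite sumr_const card_ord mulr_natr.
  apply: ler_sum => i _; rewrite normrZ ne mulr1.
  by apply: le_trans (hdot_CS _ _) _; rewrite ne mulr1.
- split; first by rewrite big1// => i _; rewrite hdot0l scale0r.
  move=> a y z hy hz; rewrite {1}hy {1}hz scaler_sumr -big_split /=.
  by apply: eq_bigr => i _; rewrite hdot_linl scalerDl scalerA.
move=> _ [i _ <-]; rewrite (bigD1 i)//= orth eqxx scale1r big1 ?addr0// => j ji.
by rewrite orth eq_sym (negPf ji) scale0r.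
Qed.

(** More than k vectors in a k-dimensional space satisfy a linear relation lam.
Taking inner products with each v i bounds the i-th coefficient times c by eps
times the sum L of all coefficients, in absolute value; adding these r estimates
gives c L <= r eps L. *)
Lemma almost_orthogonal_dim (V : set H) k r (v : 'I_r -> H) (c eps : C) :
  has_hdim V (Fin k) -> (forall i, V (v i)) -> 0 < c -> 0 <= eps ->
  (forall i, c <= hdot (v i) (v i)) ->
  (forall i l, i != l -> `|hdot (v i) (v l)| <= eps) -> r%:R * eps < c -> (r <= k)%N.
Proof.
move=> [e [orth spanE]] Vv c0 eps0 diag off small; rewrite leqNgt; apply/negP => kr.
pose M : 'M[C]_(r, k) := \matrix_(i, b) hdot (v i) (e b).
have : kermx M != 0.
  rewrite kermx_eq0; apply/negP => /eqP rk.
  by have := rank_leq_col M; rewrite rk leqNgt kr.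
move=> /rowV0Pn[lam /sub_kermxP lamM lam0].
have sum0 : \sum_i lam 0 i *: v i = 0.
  have E i : v i = \sum_b hdot (v i) (e b) *: e b.
    by apply: hdim_expand => //; rewrite spanE.
  under eq_bigr => i _ do rewrite E scaler_sumr.
  rewrite exchange_big /= big1// => b _.
  under eq_bigr => i _ do rewrite scalerA.
  rewrite -scaler_suml; have := congr1 (fun N : 'rV_k => N 0 b) lamM; rewrite !mxE.
  under eq_bigr => i _ do rewrite mxE.
  by move=> ->; rewrite scale0r.
pose L := \sum_i `|lam 0 i|.
have L0 : 0 < L.
  have /rV0Pn[i li] : lam != 0 by [].
  by apply: lt_le_trans (_ : `|lam 0 i| <= _); rewrite ?normr_gt0// /L (bigD1 i)//= lerDl sumr_ge0.
have bound i : `|lam 0 i| * c <= eps * L.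
  have : hdot (\sum_l lam 0 l *: v l) (v i) = 0 by rewrite sum0 hdot0l.
  have -> : hdot (\sum_l lam 0 l *: v l) (v i) = \sum_l lam 0 l * hdot (v l) (v i).
    elim/big_ind2 : _ => [|y1 a1 y2 a2 <- <-|l _]; first exact: hdot0l.
      exact: hdotDl.
    exact: hdotZl.
  rewrite (bigD1 i)//= => /eqP; rewrite addr_eq0 => /eqP h.
  apply: le_trans (_ : `|lam 0 i * hdot (v i) (v i)| <= _).
    by rewrite normrM ler_wpM2l// ger0_norm ?hdot_ge0.
  rewrite h normrN; apply: le_trans (ler_norm_sum _ _ _) _.
  rewrite /L mulr_sumr (bigD1 i (P := xpredT))//= ler_wpDl//.
    by rewrite mulr_ge0.
  apply: ler_sum => l li; rewrite normrM mulrC ler_wpM2r//.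
  exact: off.
have : L * c <= r%:R * eps * L.
  rewrite {1}/L mulr_suml; apply: le_trans (ler_sum _ (fun i _ => bound i)) _.
  by rewrite sumr_const card_ord -mulrA mulr_natl.
by rewrite mulrC (ler_pM2r L0) => /(lt_le_trans small); rewrite ltxx.
Qed.
End Dimension.

(** * Equivalent states *)

Section Representation.
Variables (C : numClosedFieldType) (A : cstarAlgType C) (H : hilbertType C).
Variables (pi : A -> H -> H) (rep : is_rep pi).

Lemma rep_linl (k : C) a b y : pi (k *: a + b) y = k *: pi a y + pi b y.
Proof. by case: rep. Qed.
Lemma rep_comp a b y : pi (cmul a b) y = pi a (pi b y).
Proof. by case: rep. Qed.
Lemma rep1 y : pi cone y = y.
Proof. by case: rep. Qed.
Lemma rep_adj a y z : hdot (pi a y) z = hdot y (pi (star a) z).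
Proof. by case: rep => _ _ _ _ h; rewrite -h starK. Qed.
Lemma rep0l y : pi 0 y = 0.
Proof. by have := rep_linl (-1) 0 0 y; rewrite scaler0 addr0 scaleN1r addNr. Qed.
Lemma rep_norm_sq a y : `|pi a y| ^+ 2 = hdot (pi (cmul (star a) a) y) y.
Proof. by rewrite hdot_norm rep_comp [RHS]rep_adj starK. Qed.
End Representation.

Section Equivalence.
Variables (C : numClosedFieldType) (lubC : lub_property C) (n : enat).
Variables (A : cstarAlgType C) (s : idx n -> A) (cs : cuntz_relations s).
Hypothesis gen : smallest (@closed_unital_star_subalg C A) (range s) = setT.
Local Notation S := (word_prod s).
Local Notation "x ** y" := (cmul x y) (at level 40, left associativity).

Lemma gns_norm_sq (w : A -> C) (H : hilbertType C) (pi : A -> H -> H) (Om : H) :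
  is_GNS w pi Om -> forall a, `|pi a Om| ^+ 2 = w (star a ** a).
Proof. by move=> [rep _ wE] a; rewrite rep_norm_sq// wE. Qed.

(** phi(a) = <a Om', U Om>, where U transports the cyclic vector Om of w into the
space of w'. It cannot vanish on all products of s_I with adjoints of s_K:
otherwise U Om would be orthogonal to the cyclic orbit of Om'. *)
Lemma equiv_functional (w w' : A -> C) : is_state w -> is_state w' -> state_equiv w w' ->
  exists phi : A -> C, [/\ scalar phi,
    forall a b, `|phi (star b ** a)| ^+ 2 <= w' (star a ** a) * w (star b ** b) &
    exists I K, phi (S I ** star (S K)) != 0].
Proof.
move=> ws ws' [H1 [H2 [pi1 [pi2 [Om1 [Om2 [g1 g2 [U [Ul _ Uiso Uint]]]]]]]]].
have [rep1' _ _] := g1; have [rep2 cyc _] := g2.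
pose v := U Om1; pose phi a := hdot (pi2 a Om2) v.
have phil : scalar phi by move=> k a b; rewrite /phi rep_linl// hdot_linl.
have phiCS a b : `|phi (star b ** a)| ^+ 2 <= w' (star a ** a) * w (star b ** b).
  have -> : phi (star b ** a) = hdot (pi2 a Om2) (U (pi1 b Om1)).
    by rewrite /phi rep_comp// rep_adj// starK Uint.
  rewrite -(gns_norm_sq g2) -(gns_norm_sq g1) -exprMn.
  rewrite ler_pXn2r ?nnegrE ?mulr_ge0//.
  apply: le_trans (hdot_CS _ _) _; rewrite ler_wpM2l//.
  by rewrite -(@ler_pXn2r _ 2) ?nnegrE// !hdot_norm Uiso.
exists phi; split=> //.
apply: contrapT => no.
have phi0 a : phi a = 0.
  apply: (cuntz_span cs gen (V := [set y | phi y = 0])).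
  - apply/closed_normP => y h; apply/eqP; rewrite -normr_le0.
    apply/ler_addgt0Pr => e e0; rewrite add0r.
    have [z [/= z0 yz]] := h _ e0.
    have -> : phi y = phi (y - z) by rewrite addrC -scaleN1r phil z0 mulr0 add0r.
    apply: le_trans yz; rewrite -(@ler_pXn2r _ 2) ?nnegrE//.
    have := phiCS (y - z) cone; rewrite star1 !cmul1x (state1 ws) mulr1.
    move=> /le_trans; apply; exact: (state_sq_le lubC ws').
  - by rewrite /= /phi rep0l// hdot0l.
  - by move=> k y z /= hy hz; rewrite phil hy hz mulr0 addr0.
  - move=> I K /=; apply/eqP; apply: contrapT => /negP nz.
    by apply: no; exists I, K.
have v1 : `|v| ^+ 2 = 1.
  by rewrite hdot_norm Uiso -hdot_norm -[Om1](rep1 rep1') (gns_norm_sq g1) star1 cmul1x (state1 ws).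
have clv : closure (range (fun a => pi2 a Om2)) v by rewrite cyc.
have := v1; suff -> : v = 0 by rewrite normr0 expr0n => /esym/eqP; rewrite oner_eq0.
have vn : `|v| = 1 by apply/eqP; rewrite -(@eqrXn2 _ 2)// expr1n v1.
apply/eqP; rewrite -normr_le0; apply/ler_addgt0Pr => e e0; rewrite add0r.
have [_ [[a _ <-] /= ]] := clv (ball v e) (nbhsx_ballx v e e0).
rewrite -ball_normE /= => /ltW va.
have -> : `|v| = `|hdot (v - pi2 a Om2) v|.
  by rewrite hdotBl -[hdot (pi2 a Om2) v]/(phi a) phi0 subr0 -hdot_norm v1 normr1 vn.
by apply: le_trans (hdot_CS _ _) _; rewrite vn mulr1.
Qed.

Lemma functional_left_null (w w' phi : A -> C) :
  (forall a b, `|phi (star b ** a)| ^+ 2 <= w' (star a ** a) * w (star b ** b)) ->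
  left_null w phi /\ right_null w' phi.
Proof.
move=> h; split=> b a b0; apply/eqP; rewrite -normr_eq0 -sqrf_eq0 eq_le exprn_ge0// andbT.
  by have := h a b; rewrite b0 mulr0.
by have := h b (star a); rewrite starK b0 mul0r.
Qed.

Lemma scalar0 (phi : A -> C) : scalar phi -> phi 0 = 0.
Proof. by move=> h; have := h (-1) 0 0; rewrite scaler0 addr0 mulN1r addNr. Qed.

Lemma follows_inequivalent w w' x x' : is_state w -> is_state w' ->
  follows s w x -> follows s w' x' -> (forall a b, tail x a <> tail x' b) ->
  ~ state_equiv w w'.
Proof.
move=> ws ws' wx wx' ne /(equiv_functional ws ws')[phi [phil cs' [I [K nz]]]].
have [ln rn] := functional_left_null cs'.
have [a [b [_ _ /ne//]]] := functional_support cs (scalar0 phil)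
  (fun m a => left_null_proj cs phil m a ws ln wx)
  (fun m a => right_null_proj cs phil m a ws' rn wx') nz.
Qed.

Lemma phase_inequivalent w w' x d z z' : is_state w -> is_state w' ->
  tail_period x (Fin d) -> `|z| = 1 -> `|z'| = 1 -> z <> z' ->
  follows s w x -> follows s w' x -> has_phase s w x (Fin d) z ->
  has_phase s w' x (Fin d) z' -> ~ state_equiv w w'.
Proof.
move=> ws ws' per z1 z1' zz wx wx' ph ph' /(equiv_functional ws ws')[phi [phil cs' [I [K nz]]]].
have [ln rn] := functional_left_null cs'.
have cov := left_null_covariant cs phil ws ws' z1 ln rn wx wx' ph.
have [c hc] := covariant_values cs z per I K.
move: nz; rewrite (hc _ cov); suff -> : phi cone = 0 by rewrite mulr0 eqxx.
have [_ _ _ /(_ cone)[h _]] := cov.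
have h' := right_null_eigen cs phil cone ws' rn z1' ph'.
move: h; rewrite cmulx1 -[S _]cmul1x h' => /eqP.
by rewrite -subr_eq0 -mulrBl mulf_eq0 subr_eq0 eq_sym => /orP[/eqP//|/eqP].
Qed.

(** Take I and K with phi nonzero. Then K is a prefix of x, and phi is unchanged
when the next m letters of x are inserted behind both words. Cauchy-Schwarz then
bounds the fixed number phi by the value of w' on the lengthened I. *)
Lemma follows_equiv_tail w w' x : is_state w -> is_state w' -> follows s w x ->
  state_equiv w' w -> exists I k c, 0 < c /\
    forall m, c <= w' (S (I ++ mkseq (tail x k) m) ** star (S (I ++ mkseq (tail x k) m))).
Proof.
move=> ws ws' wx /(equiv_functional ws' ws)[phi [phil cs' [I [K nz]]]].
have [ln rn] := functional_left_null cs'.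
have hr := fun m a => right_null_proj cs phil m a ws rn wx.
have KE : K = mkseq x (size K).
  apply/eqP; apply: contraNT nz => KK.
  rewrite -(hr (size K)) -cmulA /proj_word (cmulA (star (S K))).
  by rewrite word_orthogonal ?size_mkseq// cmul0l cmul0r (scalar0 phil).
exists I, (size K), (`|phi (S I ** star (S K))| ^+ 2); split.
  by rewrite exprn_gt0// normr_gt0.
move=> m; set P := I ++ _.
pose Q := mkseq x (size K + m).
have e : S I ** star (S K) ** proj_word s x (size K + m) = S P ** star (S Q).
  rewrite -cmulA.
  rewrite {1}KE proj_word_absorb_star// -KE.
  rewrite /proj_word -cmulA -star_mul cmulA -!word_prod_cat -/P; congr (_ ** star (S _)).
  by rewrite {1}KE /Q mkseq_add.
rewrite -(hr (size K + m)%N) e.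
have := cs' (star (S Q)) (star (S P)); rewrite !starK => /le_trans; apply.
by rewrite -/(proj_word s x (size K + m)) wx mul1r.
Qed.

(** The difference of the two projections is a square. *)
Lemma state_proj_decr w x a N : is_state w ->
  w (proj_word s x (a + N)) <= w (proj_word s x a).
Proof.
move=> ws; rewrite -subr_ge0 -(stateB ws).
have := state_ge0 ws ((cone - proj_word s (tail x a) N) ** star (S (mkseq x a))).
rewrite star_mul starK -cmulA (cmulA (star _)) starB star1 proj_word_star.
rewrite cmulBl !cmulBr cmul1x cmulx1 cmul1x proj_word_idem// subrr subr0.
rewrite cmulBl cmul1x cmulBr -/(proj_word s x a).
suff -> : S (mkseq x a) ** (proj_word s (tail x a) N ** star (S (mkseq x a))) =
  proj_word s x (a + N) by [].
by rewrite /proj_word mkseq_add word_prod_cat star_mul !cmulA.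
Qed.

(** The decrements g 0 - g m have a least upper bound, which is nearly reached at some M. *)
Lemma decreasing_cauchy (g : nat -> C) (eta : C) : (forall m, 0 <= g m) ->
  (forall m N, g (m + N)%N <= g m) -> 0 < eta ->
  exists M, forall m N, (M <= m)%N -> g m - g (m + N)%N <= eta.
Proof.
move=> g0 gd eta0.
have [||c [ub lb]] := lubC (S := [set g 0 - g m | m in [set: nat]]) (M := g 0).
- by exists (g 0 - g 0), 0.
- by move=> _ [m _ <-]; have := gd 0%N m; rewrite add0n subr_ge0 gerBl => -> /=.
have [M hM] : exists M, c - eta < g 0 - g M.
  apply: contrapT => no; suff /lb : forall y, [set g 0 - g m | m in [set: nat]] y -> y <= c - eta.
    by rewrite lerDl oppr_ge0 lt_geF.
  move=> _ [m _ <-]; rewrite real_leNgt ?rpredB ?ger0_real//.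
  - by apply/negP => h; apply: no; exists m.
  - by apply: ub; exists 0%N; rewrite ?subrr.
  - exact: ltW.
exists M => m N Mm; have gm : g m <= g M by rewrite -(subnKC Mm) gd.
have := ub _ (ex_intro2 _ _ (m + N)%N I erefl).
move: hM; rewrite ltrBlDr => h1 h2; have := le_lt_trans h2 h1.
rewrite -addrA ltrD2l (addrC _ eta) ltrBrDr addrC => /ltW; apply: le_trans.
by rewrite lerD2r.
Qed.

(** The vector v m is pi(s_J* ) Om for the prefix J of length m of y. Its distance
to its component q m N in the range of the next N letters is the loss of squared
norm from v m to v (m + N), which is small for large m uniformly in N. For two
different tails some N makes these ranges orthogonal, so the corresponding
vectors are almost orthogonal. *)
Lemma kspace_dim_ge (H : hilbertType C) (pi : A -> H -> H) (Om : H) (y : nat -> idx n)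
    (c : C) r k m0 :
  is_rep pi -> 0 < c -> (forall m, c <= `|pi (star (S (mkseq y m))) Om| ^+ 2) ->
  (forall m i l, (m0 <= m)%N -> (i < l < r)%N -> tail y (m + i) <> tail y (m + l)) ->
  has_hdim (Kspace s pi Om) (Fin k) -> (r <= k)%N.
Proof.
move=> rep c0 low dist dimK.
pose v m := pi (star (S (mkseq y m))) Om.
have vstep a N : v (a + N)%N = pi (star (S (mkseq (tail y a) N))) (v a).
  by rewrite /v -rep_comp// -star_mul -word_prod_cat -mkseq_add.
pose q a N := pi (proj_word s (tail y a) N) (v a).
have vq a N : `|v a - q a N| ^+ 2 = `|v a| ^+ 2 - `|v (a + N)%N| ^+ 2.
  rewrite vstep [X in _ = _ - X](rep_norm_sq rep) starK -/(proj_word s (tail y a) N).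
  rewrite hdot_norm hdotBl !hdotBr /q -hdot_norm.
  rewrite [hdot (pi _ _) (pi _ _)]rep_adj// -rep_comp// proj_word_star proj_word_idem//.
  by rewrite [hdot _ (v a)]rep_adj// proj_word_star subrr subr0.
have vdecr a N : `|v (a + N)%N| ^+ 2 <= `|v a| ^+ 2.
  by rewrite -subr_ge0 -vq exprn_ge0.
pose B := `|Om|.
have B0 : 0 <= B by exact: normr_ge0.
have vB a : `|v a| <= B.
  rewrite -(@ler_pXn2r _ 2) ?nnegrE//; have := vdecr 0%N a.
  by rewrite add0n {2}/v /= star1 rep1.
pose eps := c / (r%:R + 1).
have r1 : 0 < r%:R + 1 :> C by rewrite ltr_wpDl.
have eps0 : 0 < eps by rewrite divr_gt0.
have B1 : 0 < 2 * (B + 1) by rewrite mulr_gt0// ltr_wpDl.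
(* Two error terms of size at most dl * B must stay below eps. *)
pose dl := eps / (2 * (B + 1)).
have dl0 : 0 < dl by rewrite divr_gt0.
have [M hM] : exists M, forall m N, (M <= m)%N -> `|v m| ^+ 2 - `|v (m + N)%N| ^+ 2 <= dl ^+ 2.
  by apply: (decreasing_cauchy (g := fun m => `|v m| ^+ 2)) => [m||]; rewrite ?exprn_ge0 ?exprn_gt0.
pose m1 := maxn M m0.
have near a N : (M <= a)%N -> `|v a - q a N| <= dl.
  by move=> Ma; rewrite -(@ler_pXn2r _ 2) ?nnegrE ?(ltW dl0)// vq hM.
have small a b : (M <= a)%N -> (M <= b)%N -> tail y a <> tail y b -> `|hdot (v a) (v b)| <= eps.
  move=> Ma Mb /(proj_word_ortho cs)[N hN].
  have qq : hdot (q a N) (q b N) = 0.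
    by rewrite /q rep_adj// -rep_comp// proj_word_star hN rep0l// hdot0r.
  have -> : hdot (v a) (v b) = hdot (v a - q a N) (v b) + hdot (q a N) (v b - q b N).
    by rewrite hdotBl hdotBr qq subr0 subrK.
  have qB : `|q a N| <= B.
    have -> : `|q a N| = `|v (a + N)%N|; last exact: vB.
    apply/eqP; rewrite -(@eqrXn2 _ 2)//; apply/eqP.
    by rewrite /q /proj_word rep_comp// -vstep rep_norm_sq// word_isometry// rep1// -hdot_norm.
  apply: le_trans (ler_normD _ _) _.
  apply: le_trans (_ : dl * B + B * dl <= _).
    by apply: lerD; (apply: le_trans (hdot_CS _ _) _); apply: ler_pM => //; exact: near.
  rewrite mulrC -mulr2n -mulr_natl /dl.
  rewrite mulrA mulrCA (ler_piMr (ltW eps0))// ler_pdivrMr// mul1r.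
  by rewrite ler_wpM2l// lerDl.
apply: (almost_orthogonal_dim (v := fun i : 'I_r => v (m1 + i)%N) dimK _ c0 (ltW eps0)).
- by move=> i; apply: sub_closed_span; exists (mkseq y (m1 + i)).
- by move=> i; rewrite -hdot_norm; exact: low.
- have Mm (i : 'I_r) : (M <= m1 + i)%N by apply: leq_trans (leq_addr _ _); exact: leq_maxl.
  have mm : (m0 <= m1)%N by exact: leq_maxr.
  move=> i l il; have [h|h|h] := ltngtP i l.
  + by apply: small => //; apply: dist => //; rewrite h /=.
  + by apply: small => // e; apply: (dist m1 l i mm _ (esym e)); rewrite h /=.
  + by move: il; rewrite (val_inj h) eqxx.
- by rewrite /eps mulrCA gtr_pMr// ltr_pdivrMr// mul1r ltrDl.
Qed.

Definition prepend (I : seq (idx n)) (y : nat -> idx n) : nat -> idx n :=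
  fun i => if (i < size I)%N then nth (y 0%N) I i else y (i - size I)%N.

Lemma tail_prepend I y k : tail (prepend I y) (size I + k) = tail y k.
Proof.
apply/funext => i; rewrite /tail /prepend -addnA ltnNge leq_addr /=.
by rewrite addKn.
Qed.

Lemma mkseq_prepend I y m : mkseq (prepend I y) (size I + m) = I ++ mkseq y m.
Proof.
rewrite mkseq_add; congr (_ ++ _).
  apply: (@eq_from_nth _ (y 0%N)); rewrite size_mkseq// => i iI.
  by rewrite nth_mkseq// /prepend iI.
by rewrite -[X in tail _ X]addn0 tail_prepend.
Qed.

(** K(w') has at least r dimensions for each finite r <= d, because r consecutive
tails of y, which are tails of x, differ. *)
Lemma cdim_ge w w' x d d' : is_state w -> is_state w' -> follows s w x -> tail_period x d ->
  state_equiv w' w -> has_cdim s w' d' -> le_enat d d'.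
Proof.
move=> ws ws' wx per eqv [H [pi [Om [gns dimK]]]].
case: d' dimK => [k|] dimK; last by case: d {per}.
(* For d infinite, r = k + 1 contradicts dimension k. *)
suff hr r : le_enat (Fin r) d -> (r <= k)%N.
  case: d hr {per} => [d0|] hr /=; first by apply: hr => /=.
  by have := hr k.+1 isT; rewrite ltnn.
move=> rd; have [I [k0 [c [c0 low]]]] := follows_equiv_tail ws ws' wx eqv.
have [rep _ _] := gns.
apply: (kspace_dim_ge (y := prepend I (tail x k0)) (m0 := size I) rep c0 _ _ dimK)
  => [m|m i l Im il].
  rewrite (gns_norm_sq gns) starK -/(proj_word s _ m).
  apply: le_trans (low m) _; rewrite -mkseq_prepend addnC.
  exact: state_proj_decr.
rewrite -(subnKC Im) -!addnA !tail_prepend !tail_tail => e.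
case: d per rd {wx} => [d0|] /= per rd; last first.
  by move: il; have /eqP := per _ _ e; rewrite !eqn_add2l => /eqP ->; rewrite ltnn.
have /per.2 := e; move/eqP; rewrite !addnA !eqn_modDl => /eqP.
have /andP[il1 lr] := il.
rewrite !modn_small ?(leq_trans lr rd) ?(ltn_trans il1 (leq_trans lr rd))// => h.
by move: il1; rewrite h ltnn.
Qed.

End Equivalence.

(** * Weighted shifts and the standard basis of l2 *)

Section WeightedShift.
Variables (C : numClosedFieldType) (lubC : lub_property C) (X : choiceType).
Local Notation l2 := (l2_space lubC X).

(** F vanishes outside the range of sg, so finite sets in that range suffice. *)
Lemma has_sum_reindex (F : X -> C) (sg tau : X -> X) c : cancel sg tau ->
  (forall x, sg (tau x) != x -> F x = 0) -> has_sum (fun y => F (sg y)) c -> has_sum F c.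
Proof.
move=> sgK F0 hF e /hF[s0 h0]; exists (map sg s0) => s us sub.
pose t := [seq tau x | x <- s & sg (tau x) == x].
have -> : \sum_(x <- s) F x = \sum_(y <- t) F (sg y).
  rewrite big_map big_filter [LHS](bigID (fun x => sg (tau x) == x)) /=.
  rewrite [X in _ + X]big1 ?addr0; last by move=> x; exact: F0.
  by apply: eq_bigr => x /eqP ->.
apply: h0 => [|y ys0].
  rewrite map_inj_in_uniq ?filter_uniq// => x y.
  by rewrite !mem_filter => /andP[/eqP xE _] /andP[/eqP yE _] xy; rewrite -xE xy yE.
apply/mapP; exists (sg y); last by rewrite sgK.
by rewrite mem_filter sgK eqxx /=; apply: sub; exact: map_f.
Qed.

Variables (P : pred X) (g : X -> X) (c : X -> C).
Hypothesis ginj : {in P &, injective g}.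
Hypothesis c1 : forall x, `|c x| <= 1.

(** The form shared by the generators (P selects the words beginning with a letter,
g deletes it) and by their adjoints (g adds the letter). *)
Definition wshift_fun (f : X -> C) : X -> C^o := fun x => if P x then c x * f (g x) else 0.

Lemma wshift_sum (f : l2) s : uniq s -> \sum_(x <- s) `|wshift_fun f x| ^+ 2 <= `|f| ^+ 2.
Proof.
move=> us; apply: le_trans (_ : \sum_(y <- [seq g x | x <- s & P x]) `|f y| ^+ 2 <= _); last first.
  apply: l2_sum_le_norm; rewrite map_inj_in_uniq ?filter_uniq// => x y.
  by rewrite !mem_filter => /andP[Px _] /andP[Py _]; exact: ginj.
rewrite big_map big_filter [leRHS]big_mkcond; apply: ler_sum => x _ /=.
rewrite /wshift_fun; case: ifP => _; last by rewrite normr0 expr0n.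
by rewrite ler_pXn2r ?nnegrE// normrM ler_piMl.
Qed.

Lemma wshiftP (f : l2) : wshift_fun f \in @l2_pred C X.
Proof. by apply/asboolP; exists (`|f| ^+ 2) => s us; exact: wshift_sum. Qed.

Definition wshift (f : l2) : l2 := L2 lubC (wshiftP f).

Lemma wshift_norm f : `|wshift f| <= `|f|.
Proof. by apply: l2_norm_le => // s us; exact: wshift_sum. Qed.
End WeightedShift.

Section Basis.
Variables (C : numClosedFieldType) (lubC : lub_property C) (X : choiceType).
Local Notation l2 := (l2_space lubC X).

Lemma l2_ext (f g : l2) : (forall x, f x = g x) -> f = g.
Proof. by move=> h; apply/val_inj/funext. Qed.

Definition basis_fun (y : X) : X -> C^o := fun x => (x == y)%:R.

Lemma has_sum_single (F : X -> C) y : (forall x, x != y -> F x = 0) -> has_sum F (F y).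
Proof.
move=> F0 e e0; exists [:: y] => s us sub.
have ys : y \in s by apply: sub; rewrite inE.
rewrite (bigD1_seq y)//= big1 ?addr0 ?subrr ?normr0 ?ltW// => x; exact: F0.
Qed.

Lemma basisP y : basis_fun y \in @l2_pred C X.
Proof.
apply/asboolP; exists 1 => s us.
have h : has_sum (fun x => `|basis_fun y x| ^+ 2) (`|basis_fun y y| ^+ 2).
  apply: (has_sum_single (F := fun x => `|basis_fun y x| ^+ 2)) => x xy.
  by rewrite /basis_fun (negPf xy) normr0 expr0n.
apply: le_trans (has_sum_ub _ h us) _ => [x|]; first by rewrite exprn_ge0.
by rewrite /basis_fun eqxx normr1 expr1n.
Qed.

Definition basis y : l2 := L2 lubC (basisP y).

Lemma basisE y x : basis y x = (x == y)%:R. Proof. by []. Qed.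

Lemma hdot_basis (f : l2) y : hdot f (basis y) = f y.
Proof.
apply: has_sum_unique (l2_dotP f (basis y)) _.
have := @has_sum_single (fun x => f x * Num.conj (basis y x)) y.
rewrite basisE eqxx rmorph1 mulr1; apply => x xy.
by rewrite basisE (negPf xy) rmorph0 mulr0.
Qed.

Lemma basis_orthonormal x y : hdot (basis x) (basis y) = (x == y)%:R.
Proof. by rewrite hdot_basis basisE eq_sym. Qed.

Lemma norm_basis y : `|basis y| = 1.
Proof. by apply/eqP; rewrite -(@eqrXn2 _ 2)// expr1n hdot_norm basis_orthonormal eqxx. Qed.

Lemma l2_sum_apply (I : Type) (r : seq I) (F : I -> l2) x :
  (\sum_(i <- r) F i) x = \sum_(i <- r) F i x.
Proof. by elim: r => [|i r IH]; rewrite ?big_nil// !big_cons -IH. Qed.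

(** f is approximated by its restrictions to finite sets, whose distance to f is
the remainder of the series of squares. *)
Lemma basis_total (V : set l2) : closed V -> lin_subspace V -> (forall y, V (basis y)) ->
  forall f, V f.
Proof.
move=> /closed_normP cV [V0 Vl] Vb f; apply: cV => e e0.
have [s0 h0] := l2_dot_sqP f (exprn_gt0 2 e0).
have {h0}[s us h0] : exists2 s : seq X, uniq s & forall t, uniq t -> {subset s <= t} ->
    `|\sum_(x <- t) `|f x| ^+ 2 - l2_dot f f| <= e ^+ 2.
  exists (undup s0) => [|t ut st]; first exact: undup_uniq.
  by apply: h0 => // x xs; apply: st; rewrite mem_undup.
exists (\sum_(y <- s) f y *: basis y); split.
  elim: s {us h0} => [|y s IH]; first by rewrite big_nil.
  by rewrite big_cons; apply: Vl.
apply: l2_norm_le; first exact: ltW.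
move=> t ut; pose r := undup (s ++ t).
have ur : uniq r by rewrite undup_uniq.
set h : l2 := f - _.
have hE x : h x = if x \in s then 0 else f x.
  rewrite /h l2_addE l2_oppE l2_sum_apply; have [xs|xs] := boolP (x \in s).
    under eq_bigr do rewrite l2_scaleE basisE.
    rewrite (bigD1_seq x)//= eqxx mulr1 big1 ?addr0 ?subrr// => y yx.
    by rewrite eq_sym (negPf yx) mulr0.
  rewrite big_seq big1 ?subr0// => y ys.
  rewrite l2_scaleE basisE; have [xy|] := eqVneq x y; last by rewrite mulr0.
  by move: xs; rewrite xy ys.
clearbody h; apply: le_trans (_ : \sum_(x <- r) `|h x| ^+ 2 <= _).
  apply: (sum_subset (f := fun x => `|h x| ^+ 2)) => [x|//|//|x xt].
    by rewrite exprn_ge0.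
  by rewrite mem_undup mem_cat xt orbT.
have -> : \sum_(x <- r) `|h x| ^+ 2 = \sum_(x <- r) `|f x| ^+ 2 - \sum_(x <- s) `|f x| ^+ 2.
  have -> : \sum_(x <- s) `|f x| ^+ 2 = \sum_(x <- r | x \in s) `|f x| ^+ 2.
    rewrite -[RHS]big_filter; apply: perm_big; apply: uniq_perm; rewrite ?filter_uniq// => x.
    by rewrite mem_filter mem_undup mem_cat; case: (x \in s).
  apply/eqP; rewrite eq_sym subr_eq; apply/eqP.
  rewrite [LHS](bigID (mem s)) /= addrC; congr (_ + _).
  rewrite [RHS](bigID (mem s)) /= [X in _ = X + _]big1 ?add0r => [|x xs];
    last by rewrite hE xs normr0 expr0n.
  by apply: eq_bigr => x xs; rewrite hE (negPf xs).
have rN : \sum_(x <- r) `|f x| ^+ 2 <= l2_dot f f by exact: l2_sum_le_dot.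
apply: le_trans (_ : l2_dot f f - \sum_(x <- s) `|f x| ^+ 2 <= _); first by rewrite lerD2r.
apply: le_trans (h0 s us _); last by move=> x.
rewrite distrC; apply: real_ler_norm; rewrite rpredB// ger0_real ?l2_dot_ge0//.
by rewrite sumr_ge0// => x _; rewrite exprn_ge0.
Qed.

End Basis.

(** * The representation on the orbit of a word *)

Section OpContinuous.
Variables (C : numClosedFieldType) (lubC : lub_property C) (H : hilbertType C).
Lemma op_continuous (f : bounded_op lubC H) : continuous f.
Proof.
move=> y; apply/cvgrPdist_le => e e0.
have M0 : 0 < `|f| + 1 by rewrite ltr_wpDl.
have d0 := divr_gt0 e0 M0.
have near_y : (x : H) @[x --> y] --> y by exact: cvg_id.
move/cvgrPdist_le: near_y => /(_ _ d0) near_y.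
near=> x; have -> : f y - f x = f (y - x) by rewrite opD -scaleN1r -opZ scaleN1r.
apply: le_trans (op_le _ _) _; apply: le_trans (_ : `|f| * (e / (`|f| + 1)) <= _).
  by rewrite ler_wpM2l//; near: x.
by rewrite mulrCA (ler_piMr (ltW e0))// ler_pdivrMr// mul1r lerDl.
Unshelve. all: by end_near. Qed.

End OpContinuous.

Section OrbitRepresentation.
Variables (C : numClosedFieldType) (lubC : lub_property C) (n : enat).
Variables (j : nat -> idx n) (z : C) (z1 : `|z| = 1).

Definition orbit_pred : pred (nat -> idx n) :=
  fun x => `[< exists a b, tail x a = tail j b >].

Record orbit_type := Orbit { orbit_val : nat -> idx n; _ : orbit_pred orbit_val }.
HB.instance Definition _ := [isSub for orbit_val].
HB.instance Definition _ := [Choice of orbit_type by <:].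
Implicit Types x y : orbit_type.
Local Notation l2 := (l2_space lubC orbit_type).
Local Notation bop := (bounded_op lubC l2).

Lemma orbitP x : exists a b, tail (val x) a = tail j b.
Proof. by case: x => x /= /asboolP. Qed.

Lemma orbit_cons_subproof i x : orbit_pred (prepend [:: i] (val x)).
Proof.
have [a [b ab]] := orbitP x; apply/asboolP; exists (1 + a)%N, b.
by rewrite (tail_prepend [:: i]).
Qed.
Definition orbit_cons i x : orbit_type := Orbit (orbit_cons_subproof i x).

Lemma orbit_tail_subproof k x : orbit_pred (tail (val x) k).
Proof.
have [a [b ab]] := orbitP x; apply/asboolP; exists a, (b + k)%N.
by rewrite tail_tail addnC -tail_tail ab tail_tail.
Qed.
Definition orbit_tail k x : orbit_type := Orbit (orbit_tail_subproof k x).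

Lemma orbit_base_subproof : orbit_pred j.
Proof. by apply/asboolP; exists 0%N, 0%N. Qed.
Definition orbit_base : orbit_type := Orbit orbit_base_subproof.

Lemma orbit_consK i : cancel (orbit_cons i) (orbit_tail 1).
Proof. by move=> x; apply: val_inj; rewrite /= -[1%N]addn0 (tail_prepend [:: i]). Qed.

Lemma orbit_tailK x : orbit_cons (val x 0%N) (orbit_tail 1 x) = x.
Proof.
apply: val_inj; apply/funext => k /=; rewrite /prepend /=.
by case: k => [|k] //=; rewrite /tail add1n subn1.
Qed.

Lemma orbit_cons0 i x : val (orbit_cons i x) 0%N = i. Proof. by []. Qed.

Lemma orbit_tail_add a b x : orbit_tail b (orbit_tail a x) = orbit_tail (a + b) x.
Proof. by apply: val_inj; rewrite /= tail_tail. Qed.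

Lemma orbit_tail0 x : orbit_tail 0 x = x.
Proof. by apply: val_inj. Qed.

(** The weight of the edge that leads to x. Only the edge to the base point is
weighted, so a loop through it collects the factor z exactly once. *)
Definition phase x : C := if x == orbit_base then z else 1.

Lemma norm_phase x : `|phase x| = 1.
Proof. by rewrite /phase; case: ifP => _; rewrite ?normr1. Qed.

Lemma phase_conj x : Num.conj (phase x) * phase x = 1.
Proof. by rewrite mulrC -normCK norm_phase expr1n. Qed.

Lemma shift_inj i : {in (fun x => val x 0%N == i) &, injective (orbit_tail 1)}.
Proof.
move=> x y /eqP xi /eqP yi xy.
by rewrite -(orbit_tailK x) -(orbit_tailK y) xi yi xy.
Qed.

Lemma phase_le1 x : `|phase x| <= 1. Proof. by rewrite norm_phase. Qed.

Lemma cons_inj i : {in predT &, injective (orbit_cons i)}.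
Proof. by move=> x y _ _; exact: (can_inj (orbit_consK i)). Qed.

Lemma phase_cons_le1 i x : `|Num.conj (phase (orbit_cons i x))| <= 1.
Proof. by rewrite norm_conjC norm_phase. Qed.

Definition creation_fun i : l2 -> l2 := wshift (shift_inj (i := i)) phase_le1.
Definition annihilation_fun i : l2 -> l2 := wshift (cons_inj (i := i)) (phase_cons_le1 i).

Lemma creation_funE i f x :
  creation_fun i f x = if val x 0%N == i then phase x * f (orbit_tail 1 x) else 0.
Proof. by []. Qed.

Lemma annihilation_funE i f x :
  annihilation_fun i f x = Num.conj (phase (orbit_cons i x)) * f (orbit_cons i x).
Proof. by []. Qed.

Lemma creation_adj i f h : hdot (creation_fun i f) h = hdot f (annihilation_fun i h).
Proof.
apply: has_sum_unique (l2_dotP _ _) _.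
apply: (has_sum_reindex (orbit_consK i)) => [x xi|].
  rewrite creation_funE; case: eqP => [xE|_]; last by rewrite mul0r.
  by move: xi; rewrite -xE orbit_tailK eqxx.
move: (l2_dotP f (annihilation_fun i h)); apply: eq_has_sum => x.
rewrite annihilation_funE creation_funE orbit_cons0 eqxx orbit_consK.
by rewrite rmorphM /= conjCK mulrCA mulrA.
Qed.

Lemma creationP i : creation_fun i \in @bop_pred C l2.
Proof.
apply/asboolP; split; first by exists (annihilation_fun i); exact: creation_adj.
by exists 1 => // f; rewrite mul1r; exact: wshift_norm.
Qed.

Lemma annihilationP i : annihilation_fun i \in @bop_pred C l2.
Proof.
apply/asboolP; split.
  by exists (creation_fun i) => f h; rewrite hdot_conj -creation_adj -hdot_conj.
by exists 1 => // f; rewrite mul1r; exact: wshift_norm.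
Qed.

Definition creation i : bop := BOp lubC (creationP i).
Definition annihilation i : bop := BOp lubC (annihilationP i).

Lemma star_creation i : star (creation i) = annihilation i.
Proof. by apply: op_adj_unique; exact: creation_adj. Qed.

Lemma creation_isometry i k : cmul (star (creation i)) (creation k) = (i == k)%:R *: cone.
Proof.
rewrite star_creation; apply: op_ext => f; apply: l2_ext => x.
rewrite op_scaleE l2_scaleE.
transitivity (Num.conj (phase (orbit_cons i x)) * creation_fun k f (orbit_cons i x)); first by [].
rewrite creation_funE orbit_cons0 orbit_consK; case: eqP => _.
  by rewrite mulrA phase_conj.
by rewrite mulr0 mul0r.
Qed.

Lemma creation_proj i f x :
  (cmul (creation i) (star (creation i)) : bop) f x = if val x 0%N == i then f x else 0.
Proof.
rewrite star_creation.
transitivity (creation_fun i (annihilation_fun i f) x); first by [].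
rewrite creation_funE annihilation_funE; case: eqP => // xi.
rewrite -{2}xi orbit_tailK -[X in orbit_cons X]xi orbit_tailK.
by rewrite mulrA [phase x * _]mulrC phase_conj mul1r.
Qed.

Lemma op_sum_apply (I : Type) (r : seq I) (F : I -> bop) f :
  (\sum_(i <- r) F i) f = \sum_(i <- r) F i f.
Proof. by elim: r => [|i r IH]; rewrite ?big_nil// !big_cons -IH. Qed.

End OrbitRepresentation.

(** Every word begins with exactly one letter, so the range projections add up to
the identity; for infinitely many letters the finite sums are the projections
onto the words beginning with one of the first k letters. *)
Lemma creation_cuntz (C : numClosedFieldType) (lubC : lub_property C) (n : enat)
  (j : nat -> idx n) (z : C) (z1 : `|z| = 1) : cuntz_relations (creation lubC j z1).
Proof.
case: n j => [m|] j; split.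
- by move=> i k; exact: (creation_isometry lubC (n := Fin m)).
- apply: op_ext => f; apply: l2_ext => x; rewrite op_sum_apply l2_sum_apply.
  under eq_bigr do rewrite creation_proj.
  by rewrite -big_mkcond /= (big_pred1 (val x 0%N)) => [//|i]; rewrite eq_sym.
- by move=> i k; exact: (creation_isometry lubC (n := Inf)).
move=> k _; set p := \sum_(i < k) _.
have ps : star p = p.
  rewrite /p; elim/big_ind : _ => [|a b ha hb|i _]; first exact: star0.
    by rewrite starD ha hb.
  by rewrite star_mul starK.
have pp : cmul p p = p.
  apply: op_ext => f; apply: l2_ext => x.
  have pE h y : (p : bounded_op lubC _) h y = if (val y 0 < k)%N then h y else 0.
    rewrite /p op_sum_apply l2_sum_apply.
    under eq_bigr do rewrite creation_proj.
    rewrite -big_mkcond /=; case: ltnP => yk.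
      rewrite (big_pred1 (Ordinal yk)) => [//|i] /=.
      by apply/eqP/eqP => [yi|->//]; apply: val_inj; rewrite /= -yi.
    rewrite big1// => i /eqP yi; move: (ltn_ord i); rewrite -yi ltnNge yk//.
  transitivity ((p : bounded_op lubC _) ((p : bounded_op lubC _) f) x); first by [].
  by rewrite pE; case: ifP => // xk; rewrite pE xk.
exists (cone - p); rewrite starB star1 ps cmulBl !cmulBr cmul1x cmulx1 cmul1x pp.
by rewrite subrr subr0.
Qed.

Section VectorState.
Variables (C : numClosedFieldType) (lubC : lub_property C) (n : enat).
Variables (A : cstarAlgType C) (s : idx n -> A) (cA : is_cuntz_algebra s).
Variables (j : nat -> idx n) (z : C) (z1 : `|z| = 1) (d : enat) (per : tail_period j d).
Local Notation S := (word_prod s).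
Local Notation l2 := (l2_space lubC (orbit_type j)).
Local Notation bop := (bounded_op lubC l2).
Local Notation delta := (@basis C lubC (orbit_type j)).
Local Notation base := (orbit_base j).
Local Notation phase := (phase z).
Implicit Types x y : orbit_type j.

Lemma creation_basis x :
  creation lubC j z1 (val x 0%N) (delta (orbit_tail 1 x)) = phase x *: delta x.
Proof.
apply: l2_ext => y; rewrite l2_scaleE basisE.
transitivity (if val y 0%N == val x 0%N
  then phase y * delta (orbit_tail 1 x) (orbit_tail 1 y) else 0).
  by [].
rewrite basisE; have [->|yx] := eqVneq y x; first by rewrite !eqxx.
case: eqP => [e|_]; last by rewrite mulr0.
have [t|_] := eqVneq (orbit_tail 1 y) (orbit_tail 1 x); last by rewrite !mulr0.
by move: yx; rewrite -(orbit_tailK y) -(orbit_tailK x) e t eqxx.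
Qed.

Lemma annihilation_basis i x : annihilation lubC j z1 i (delta x) =
  (if val x 0%N == i then Num.conj (phase x) else 0) *: delta (orbit_tail 1 x).
Proof.
apply: l2_ext => y; rewrite l2_scaleE basisE.
transitivity (Num.conj (phase (orbit_cons i y)) * delta x (orbit_cons i y)); first by [].
rewrite basisE; have [<-|yx] := eqVneq (orbit_cons i y) x.
  by rewrite orbit_cons0 orbit_consK !eqxx.
rewrite mulr0; case: eqP => [e|_]; last by rewrite mul0r.
have [t|_] := eqVneq y (orbit_tail 1 x); last by rewrite mulr0.
by move: yx; rewrite t -e orbit_tailK eqxx.
Qed.

Lemma orbit_hom_exists : exists f : A -> bop,
  unital_star_hom f /\ forall i, f (s i) = creation lubC j z1 i.
Proof. by case: cA => _ _ univ; exact: (univ _ _ (creation_cuntz lubC j z1)). Qed.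

Definition orbit_hom := sval (cid orbit_hom_exists).
Definition orbit_rep (a : A) (f : l2) : l2 := orbit_hom a f.

Lemma orbit_homP : unital_star_hom orbit_hom.
Proof. by rewrite /orbit_hom; case: cid => f []. Qed.

Lemma orbit_hom_gen i : orbit_hom (s i) = creation lubC j z1 i.
Proof. by rewrite /orbit_hom; case: cid => f []. Qed.

Lemma orbit_rep_is_rep : is_rep orbit_rep.
Proof.
have [fl f1 fM fs] := orbit_homP; split.
- by move=> a; split; [exact: op_linear|exact: op_continuous].
- by move=> k a b x; rewrite /orbit_rep fl.
- by move=> x; rewrite /orbit_rep f1.
- by move=> a b x; rewrite /orbit_rep fM.
- by move=> a x y; rewrite /orbit_rep fs; exact: op_adjPr.
Qed.

Lemma orbit_rep_star_gen i : orbit_rep (star (s i)) = annihilation lubC j z1 i :> (l2 -> l2).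
Proof. by have [_ _ _ fs] := orbit_homP; rewrite /orbit_rep fs orbit_hom_gen star_creation. Qed.

Lemma orbit_rep_gen i : orbit_rep (s i) = creation lubC j z1 i :> (l2 -> l2).
Proof. by rewrite /orbit_rep orbit_hom_gen. Qed.

Let rep := orbit_rep_is_rep.

Lemma rep_opZ a c f : orbit_rep a (c *: f) = c *: orbit_rep a f.
Proof. exact: opZ. Qed.

Lemma orbit_rep_word_star K x : exists c : C,
  orbit_rep (star (S K)) (delta x) = c *: delta (orbit_tail (size K) x).
Proof.
elim: K x => [|i K IH] x.
  by exists 1; rewrite /= star1 (rep1 rep) scale1r orbit_tail0.
have [c hc] := IH (orbit_tail 1 x).
exists ((if val x 0%N == i then Num.conj (phase x) else 0) * c).
rewrite /= star_mul (rep_comp rep) orbit_rep_star_gen annihilation_basis rep_opZ hc scalerA.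
by rewrite orbit_tail_add.
Qed.

(** Each letter removed contributes the conjugate of the phase of the word it is removed from. *)
Lemma orbit_rep_prefix_star x m : orbit_rep (star (S (mkseq (val x) m))) (delta x) =
  (\prod_(k < m) Num.conj (phase (orbit_tail k x))) *: delta (orbit_tail m x).
Proof.
elim: m x => [|m IH] x.
  by rewrite /= star1 (rep1 rep) big_ord0 scale1r orbit_tail0.
have -> : mkseq (val x) m.+1 = val x 0%N :: mkseq (val (orbit_tail 1 x)) m.
  by rewrite -[m.+1]/(1 + m)%N mkseq_add.
rewrite /= star_mul (rep_comp rep) orbit_rep_star_gen annihilation_basis rep_opZ eqxx.
rewrite (IH (orbit_tail 1 x)) scalerA.
rewrite orbit_tail_add big_ord_recl orbit_tail0; congr (_ * _ *: _).
Qed.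

Lemma orbit_rep_prefix x a : exists2 c : C, c != 0 &
  orbit_rep (S (mkseq (val x) a)) (delta (orbit_tail a x)) = c *: delta x.
Proof.
have p0 y : phase y != 0 by rewrite -normr_eq0 norm_phase// oner_eq0.
elim: a x => [|a IH] x.
  by exists 1; rewrite ?oner_eq0// /= (rep1 rep) scale1r orbit_tail0.
have [c c0 hc] := IH (orbit_tail 1 x).
exists (c * phase x); first by rewrite mulf_neq0.
have -> : mkseq (val x) a.+1 = val x 0%N :: mkseq (val (orbit_tail 1 x)) a.
  by rewrite -[a.+1]/(1 + a)%N mkseq_add.
rewrite /= (rep_comp rep) -[a.+1]/(1 + a)%N -orbit_tail_add hc rep_opZ orbit_rep_gen.
by rewrite creation_basis scalerA.
Qed.

Definition orbit_state (a : A) : C := hdot (orbit_rep a (delta base)) (delta base).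

Lemma orbit_state_is_state : is_state orbit_state.
Proof.
split.
- by move=> k a b; rewrite /orbit_state (rep_linl rep) hdot_linl.
- by move=> a; rewrite /orbit_state -(rep_norm_sq rep) exprn_ge0.
- by rewrite /orbit_state (rep1 rep) basis_orthonormal eqxx.
Qed.

Lemma norm_prod_phase m x : `|\prod_(k < m) Num.conj (phase (orbit_tail k x))| = 1.
Proof. by rewrite normr_prod big1// => k _; rewrite norm_conjC norm_phase. Qed.

Lemma orbit_state_follows : follows s orbit_state j.
Proof.
move=> m; rewrite /orbit_state /proj_word (rep_comp rep) (rep_adj rep) -hdot_norm.
rewrite (orbit_rep_prefix_star base) normrZ norm_prod_phase norm_basis mulr1.
by rewrite expr1n.
Qed.

Lemma orbit_tail_base_eq k : (orbit_tail k base == base) -> tail j k = j.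
Proof. by move=> /eqP/(congr1 val). Qed.

(** Among the d tails of the periodic word only the first is the base point, so
the product of the phases is z. *)
Lemma orbit_state_phase : has_phase s orbit_state j d z.
Proof.
case: d per => [d0|] //= [d00 perP].
rewrite /orbit_state (rep_adj rep) (orbit_rep_prefix_star base).
have -> : orbit_tail d0 base = base.
  by apply: val_inj; rewrite /=; apply/(perP d0 0%N); rewrite modnn mod0n.
rewrite hdotZr basis_orthonormal eqxx mulr1 rmorph_prod /=.
case: d0 d00 perP => // d0 _ perP; rewrite big_ord_recl big1 ?mulr1 => [|k _].
  by rewrite orbit_tail0 conjCK /phase eqxx.
rewrite conjCK /phase; case: ifP => // /orbit_tail_base_eq.
move=> /(perP _ 0%N)/eqP; rewrite mod0n modn_small//.
Qed.

(** Any word in the orbit is reached from the base point by deleting a prefix and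
adding another, so the closed orbit of the base vector contains the basis. *)
Lemma orbit_GNS : is_GNS orbit_state orbit_rep (delta base).
Proof.
split=> //.
pose V : set l2 := closure (range (fun a => orbit_rep a (delta base))).
have cV : closed V by exact: closed_closure.
have rV a : range (fun a => orbit_rep a (delta base)) (orbit_rep a (delta base)) by exists a.
have Vl : lin_subspace V.
  split; first by apply: subset_closure; exists 0 => //; rewrite (rep0l rep).
  move=> k f g Vf Vg; move/closed_normP: (cV); apply => e e0.
  have M0 : 0 < `|k| + 1 by rewrite ltr_wpDl.
  have e2 : 0 < e / 2 by rewrite divr_gt0.
  have [_ [[a _ <-]]] := Vf _ (nbhsx_ballx f _ (divr_gt0 e2 M0)).
  have [_ [[b _ <-]]] := Vg _ (nbhsx_ballx g _ e2).
  rewrite -!ball_normE /= => /ltW gb /ltW fa.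
  exists (orbit_rep (k *: a + b) (delta base)); split; first exact: subset_closure.
  rewrite (rep_linl rep) opprD addrACA -scalerBr (splitr e).
  apply: le_trans (ler_normD _ _) _; apply: lerD => //; rewrite normrZ.
  apply: le_trans (_ : `|k| * (e / 2 / (`|k| + 1)) <= _); first by rewrite ler_wpM2l.
  by rewrite mulrCA (ler_piMr (ltW e2))// ler_pdivrMr// mul1r lerDl.
apply/seteqP; split=> // f _; apply: (basis_total cV Vl) => x.
have [a [b ab]] := orbitP x.
have [c c0 hc] := orbit_rep_prefix x a.
pose c' := \prod_(k < b) Num.conj (phase (orbit_tail k base)).
have c'0 : c' != 0 by rewrite -normr_eq0 norm_prod_phase oner_eq0.
have -> : delta x =
    orbit_rep ((c * c')^-1 *: cmul (S (mkseq (val x) a)) (star (S (mkseq j b)))) (delta base).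
  rewrite -[_ *: _]addr0 (rep_linl rep) (rep0l rep) addr0 (rep_comp rep).
  rewrite (orbit_rep_prefix_star base) rep_opZ.
  have -> : orbit_tail b base = orbit_tail a x by apply: val_inj.
  by rewrite hc !scalerA -/c' -mulrA [c' * c]mulrC mulVf ?scale1r// mulf_neq0.
exact: subset_closure.
Qed.

Definition idx_nat (d' : enat) : idx d' -> nat :=
  match d' with Fin m => fun k : 'I_m => val k | Inf => fun k : nat => k end.

Lemma tail_idx_inj (k l : idx d) : tail j (idx_nat k) = tail j (idx_nat l) -> k = l.
Proof.
case: d per k l => [d0|] /= per' k l; last exact: per'.
by move=> /per'.2; rewrite !modn_small// => /val_inj.
Qed.

Lemma tail_idx_exists m : exists k : idx d, tail j m = tail j (idx_nat k).
Proof.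
case: d per => [d0|] /= per'; last by exists m.
exists (Ordinal (ltn_pmod m per'.1)) => /=.
by apply/per'.2; rewrite modn_mod.
Qed.

(** The adjoints of words take the base vector to multiples of the basis vectors
of its tails, and every tail occurs. *)
Lemma orbit_state_cdim : has_cdim s orbit_state d.
Proof.
exists l2, orbit_rep, (delta base); split; first exact: orbit_GNS.
pose e (k : idx d) := delta (orbit_tail (idx_nat k) base); exists e; split.
  move=> k l; rewrite basis_orthonormal.
  suff -> : (orbit_tail (idx_nat k) base == orbit_tail (idx_nat l) base) = (k == l) by [].
  by apply/eqP/eqP => [kl|->//]; apply: tail_idx_inj; exact: (congr1 val kl).
apply/seteqP; split; apply: closed_span_sub;
  try exact: closed_span_closed; try exact: closed_span_lin.
  move=> _ [k _ <-].
  have h := orbit_rep_prefix_star base (idx_nat k).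
  set c := \prod_(_ < _) _ in h.
  have c0 : c != 0 by rewrite -normr_eq0 norm_prod_phase oner_eq0.
  have -> : e k = c^-1 *: orbit_rep (star (S (mkseq j (idx_nat k)))) (delta base) + 0.
    by rewrite h scalerA mulVf// scale1r addr0.
  have [Z0 Zl] := closed_span_lin (range (fun J => orbit_rep (star (S J)) (delta base))).
  by apply: Zl => //; apply: sub_closed_span; exists (mkseq j (idx_nat k)).
move=> _ [K _ <-]; have [c ->] := orbit_rep_word_star K base.
have [k hk] := tail_idx_exists (size K).
have -> : orbit_tail (size K) base = orbit_tail (idx_nat k) base by apply: val_inj.
have [Z0 Zl] := closed_span_lin (range e).
by rewrite -[_ *: _]addr0; apply: Zl => //; apply: sub_closed_span; exists k.
Qed.

Lemma orbit_state_equiv_refl : state_equiv orbit_state orbit_state.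
Proof.
exists l2, l2, orbit_rep, orbit_rep, (delta base), (delta base).
split; try exact: orbit_GNS.
exists idfun; split=> //.
by apply/seteqP; split=> // f _; exists f.
Qed.
End VectorState.

(** * Continuously many words and phases *)

Section Family.
Variables (C : numClosedFieldType) (lubC : lub_property C) (n : enat).
Variables (A : cstarAlgType C) (s : idx n -> A) (cA : is_cuntz_algebra s).

Lemma minimal_state_exists d (x : nat -> idx n) (z : C) : tail_period x d -> `|z| = 1 ->
  exists w : A -> C, [/\ is_state w, follows s w x, has_phase s w x d z, has_cdim s w d
    & state_equiv w w].
Proof.
move=> per z1; exists (orbit_state lubC cA x z1); split.
- exact: orbit_state_is_state.
- exact: orbit_state_follows.
- exact: orbit_state_phase.
- exact: orbit_state_cdim.
- exact: orbit_state_equiv_refl.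
Qed.

Lemma family_of_states (T : Type) d (x : T -> nat -> idx n) (z : T -> C) :
  (forall t, `|z t| = 1) -> (forall t, tail_period (x t) d) ->
  (forall t u, t <> u -> (forall a b, tail (x t) a <> tail (x u) b) \/
     [/\ x t = x u, z t <> z u & exists d0, d = Fin d0]) ->
  exists F : T -> A -> C,
    [/\ forall t u, t <> u -> F t <> F u,
        forall t, [/\ is_pure (F t), is_minimal s (F t) & has_kappa s (F t) d] &
        forall t u, t <> u -> ~ state_equiv (F t) (F u)].
Proof.
move=> z1 per sep; have [cs gen _] := cA.
have /choice[F hF] := fun t => minimal_state_exists (per t) (z1 t).
have ineq t u : t <> u -> ~ state_equiv (F t) (F u).
  have [wt ft pt _ _] := hF t; have [wu fu pu _ _] := hF u.
  move=> /sep[ne|[xx zz [d0 dE]]]; first exact: (follows_inequivalent lubC cs gen wt wu ft fu ne).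
  have pert := per t; rewrite -xx in fu pu; rewrite dE in pert pt pu.
  exact: (phase_inequivalent lubC cs gen wt wu pert (z1 t) (z1 u) zz ft fu pt pu).
exists F; split=> //.
  move=> t u tu Ftu; apply: (ineq _ _ tu); rewrite -Ftu.
  by have [] := hF t.
move=> t; have [wt ft pt ct et] := hF t.
have kt : has_kappa s (F t) d.
  split; first by exists (F t).
  by move=> w' d' ws' eqv cd'; exact: (cdim_ge lubC cs gen wt ws' ft (per t) eqv cd').
split=> //; last by exists d.
exact: (follows_pure lubC cs gen (per t) (z1 t) wt ft pt).
Qed.
End Family.

Section Alphabet.
Local Open Scope nat_scope.
Variables (T : Type) (l0 l1 : T).
Hypothesis l01 : l0 <> l1.

Definition periodic_word d (i : nat) : T := if i %% d == d.-1 then l1 else l0.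

(** l1 occurs exactly at the positions congruent to d - 1. *)
Lemma periodic_word_tail d a b : (0 < d)%N ->
  tail (periodic_word d) a = tail (periodic_word d) b <-> a = b %[mod d].
Proof.
move=> d0; split=> [ab|ab]; last first.
  by apply/funext => i; rewrite /tail /periodic_word -modnDml ab modnDml.
(* i leads from a to the next occurrence of l1. *)
pose i := (d.-1 - a %% d)%N.
have ai : (a + i) %% d = d.-1.
  rewrite -modnDml /i subnKC; last by rewrite -ltnS prednK// ltn_mod.
  by rewrite modn_small// prednK.
have := congr1 (fun f => f i) ab; rewrite /tail /periodic_word ai eqxx.
case: eqP => [bi _|_ /esym/l01//].
by apply/eqP; rewrite -(eqn_modDr i) ai bi.
Qed.

Definition marked_word (M : nat -> bool) (i : nat) : T := if M i then l1 else l0.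

Lemma marked_word_tail M M' a b :
  tail (marked_word M) a = tail (marked_word M') b ->
  forall i, M (a + i)%N = M' (b + i)%N.
Proof.
move=> ab i; have := congr1 (fun f => f i) ab; rewrite /tail /marked_word.
by case: (M _); case: (M' _) => // e; case: l01; rewrite e.
Qed.
End Alphabet.

Section CutMarks.
Variable R : realType.
Implicit Types t u : R.

(** Bit l tells on which side of t the rational number of index logn 2 l.+1 lies.
Each rational number is tested by infinitely many bits, so that any tail of the
bits determines t. *)
Definition cut_bit t (l : nat) : bool :=
  if @unpickle rat (logn 2 l.+1) is Some q then ratr q < t else false.

(** The even powers of two are always marked and align any two words that have a
common tail; the odd ones carry the bits. *)
Definition cut_mark t (p : nat) : bool :=
  `[< exists k, p = (2 ^ k)%N /\ (odd k -> cut_bit t k./2) >].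

Lemma cut_mark_even t k : cut_mark t (2 ^ k.*2).
Proof. by apply/asboolP; exists k.*2; rewrite odd_double. Qed.

Lemma cut_mark_odd t l : cut_mark t (2 ^ l.*2.+1) = cut_bit t l.
Proof.
apply/asboolP/idP => [[k [/eqP e h]]|h].
  by move: e h; rewrite eqn_exp2l// => /eqP <- /=; rewrite odd_double uphalf_double; exact.
by exists l.*2.+1; split=> // _; rewrite /= uphalf_double.
Qed.

(** Aligning position a with a later position b takes a marked even power of two
beyond b to a larger marked power of two, at a distance of at most b; but powers of
two that large are further apart. *)
Lemma cut_mark_shift t u a b : (forall i, cut_mark t (a + i) = cut_mark u (b + i)) -> (b <= a)%N.
Proof.
move=> h; rewrite leqNgt; apply/negP => ab.
have bp : (b < 2 ^ b.*2)%N.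
  by apply: leq_trans (ltn_expl b (isT : (1 < 2)%N)) _; rewrite leq_exp2l// -addnn leq_addr.
have := h (2 ^ b.*2 - a)%N; rewrite subnKC ?(leq_trans (ltnW ab) (ltnW bp))// cut_mark_even.
move=> /esym/asboolP[k [e _]].
have e' : (2 ^ k = 2 ^ b.*2 + (b - a))%N.
  by rewrite -e addnBA ?(leq_trans (ltnW ab) (ltnW bp))// addnC addnBA ?(ltnW ab).
have lt1 : (2 ^ b.*2 < 2 ^ k)%N by rewrite e' -[X in (X < _)%N]addn0 ltn_add2l subn_gt0.
have : (2 ^ b.*2.+1 <= 2 ^ k)%N by rewrite leq_exp2l// -(ltn_exp2l _ _ (isT : (1 < 2)%N)).
rewrite e' expnS mul2n -addnn leq_add2l leqNgt => /negP; apply.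
by apply: leq_ltn_trans bp; exact: leq_subr.
Qed.

(** A rational number strictly between t and u is tested by bits of arbitrarily
large index, obtained by multiplying a fixed power of two by odd numbers. *)
Lemma cut_bit_separates t u a : t < u -> exists2 l, (a <= l)%N & cut_bit t l != cut_bit u l.
Proof.
move=> /rat_in_itvoo[q]; rewrite in_itv /= => /andP[tq qu].
(* The odd factor makes the index large and leaves its 2-valuation at pickle q. *)
pose m := (2 ^ pickle q * a.*2.+1)%N.
have m0 : (0 < m)%N by rewrite muln_gt0 expn_gt0.
exists m.-1.
  rewrite -ltnS prednK// /m; apply: leq_trans (_ : (a.*2.+1 <= _)%N).
    by rewrite ltnS -addnn leq_addr.
  by rewrite leq_pmull// expn_gt0.
rewrite /cut_bit prednK// /m lognM ?expn_gt0// pfactorK//.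
rewrite [logn 2 a.*2.+1]logn_coprime ?addn0 ?pickleK.
  by rewrite qu ltNge (ltW tq).
by rewrite coprime2n /= odd_double.
Qed.

Lemma cut_mark_separates t u a b :
  (forall i, cut_mark t (a + i) = cut_mark u (b + i)) -> t = u /\ a = b.
Proof.
move=> h; have ab : a = b.
  apply/eqP; rewrite eqn_leq (cut_mark_shift h) andbT.
  by apply: (@cut_mark_shift u t) => i; rewrite h.
split=> //; rewrite -ab in h.
have bits l : (a <= l)%N -> cut_bit t l = cut_bit u l.
  move=> al; rewrite -!cut_mark_odd.
  have le : (a <= 2 ^ l.*2.+1)%N.
    apply: leq_trans al _; apply: leq_trans (ltnW (ltn_expl l (isT : (1 < 2)%N))) _.
    by rewrite leq_exp2l// -addnn -addnS leq_addr.
  by rewrite -(subnKC le) h.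
have [tu|ut|//] := ltgtP t u.
  by have [l al] := cut_bit_separates a tu; rewrite bits// eqxx.
by have [l al] := cut_bit_separates a ut; rewrite bits// eqxx.
Qed.
End CutMarks.

Section Circle.
Variable R : realType.

(** The rational parametrization (1 + i t) / (1 - i t). *)
Definition circle_point (t : R) : R[i] :=
  Complex ((1 - t ^+ 2) / (1 + t ^+ 2)) ((t *+ 2) / (1 + t ^+ 2)).

Lemma circle_den (t : R) : 1 + t ^+ 2 != 0.
Proof. by rewrite gt_eqF// ltr_pwDl// sqr_ge0. Qed.

Lemma norm_circle_point t : `|circle_point t| = 1.
Proof.
rewrite normc_def /= (_ : _ + _ = 1) ?sqrtr1//.
by field; exact: circle_den.
Qed.

Lemma circle_point_inj : injective circle_point.
Proof.
have H (t : R) : complex.Im (circle_point t) / (1 + complex.Re (circle_point t)) = t.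
  rewrite /=; field; rewrite circle_den /=.
  by rewrite (_ : _ + _ = 2) ?pnatr_eq0//; ring.
by move=> t u tu; rewrite -(H t) tu H.
Qed.
End Circle.

Local Open Scope card_scope.

Lemma idx_two_letters n : le_enat (Fin 2) n -> exists l0 l1 : idx n, l0 <> l1.
Proof.
case: n => [[|[|n]]|] //= _; last by exists 0%N, 1%N.
by exists ord0, ord_max => /(congr1 val).
Qed.

Theorem theorem3p24 (R : realType) (n d : enat) (A : cstarAlgType R[i])
    (s : idx n -> A) (hn : le_enat (Fin 2) n) (hd : le_enat (Fin 1) d)
    (hA : is_cuntz_algebra s) :
  exists S : set (A -> R[i]),
    [/\ S #= [set: R],
        forall w, S w -> [/\ is_pure w, is_minimal s w & has_kappa s w d] &
        forall w w', S w -> S w' -> w <> w' -> ~ state_equiv w w'].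
Proof.
have [l0 [l1 l01]] := idx_two_letters hn.
suff [F [Finj Fgood Fsep]] : exists F : R -> A -> R[i],
    [/\ forall t u, t <> u -> F t <> F u,
        forall t, [/\ is_pure (F t), is_minimal s (F t) & has_kappa s (F t) d] &
        forall t u, t <> u -> ~ state_equiv (F t) (F u)].
  exists (range F); split.
  - apply: inj_card_eq => t u _ _ tu; apply: contrapT => /Finj; exact.
  - by move=> _ [t _ <-].
  - by move=> _ _ [t _ <-] [u _ <-] tu; apply: Fsep => e; apply: tu; rewrite e.
case: d hd => [d0|] /= d1.
  apply: (family_of_states (@complex_lub R) hA
    (x := fun _ => periodic_word l0 l1 d0) (z := @circle_point R)).
  - exact: norm_circle_point.
  - by move=> _; split=> // a b; exact: periodic_word_tail.
  - move=> t u tu; right; split=> //; last by exists d0.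
    by move/circle_point_inj.
apply: (family_of_states (@complex_lub R) hA
  (x := fun t => marked_word l0 l1 (cut_mark t)) (z := fun=> 1)).
- by move=> _; rewrite normr1.
- by move=> t a b /(marked_word_tail l01)/cut_mark_separates[].
- move=> t u tu; left => a b /(marked_word_tail l01)/cut_mark_separates[e _].
  exact: tu.
Qed.
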